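(* Let $G$ be a finite simple graph. For every integer $i$ with $0\le i\le 5$, the $i$th Betti number $\beta_i^K(G)$ of the Stanley-Reisner ring $K[\Delta(G)]$ does not depend on the characteristic of the field $K$ (that is, $\beta_i^K(G)$ takes the same value for all fields $K$).
   Context: For a finite simple graph $G$ with vertex set $V(G)$ and edge set $E(G)$, and a field $K$, let $K(G)$ be the polynomial ring over $K$ whose variables are the vertices of $G$, and let $I(G)$ be the ideal generated by all monomials $uv$ with $(u,v)\in E(G)$. $\Delta(G)$ is the simplicial complex on $V(G)$ whose faces are the sets of vertices no two of which are joined by an edge of $G$, so that $K[\Delta(G)]=K(G)/I(G)$ is its Stanley-Reisner ring. $\beta_{i,d}^K(G)$ denotes the $i$th graded Betti number of degree $d$ of $K[\Delta(G)]$: in a graded minimal free resolution of $K[\Delta(G)]$ over $R=K(G)$, the $i$th free module is $\bigoplus_d R(-d)^{\beta_{i,d}^K(G)}$. Further $\beta_i^K(G)=\sum_d\beta_{i,d}^K(G)$. *)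

(* Defs.v *)
From HB Require Import structures.
From mathcomp Require Import all_boot all_order all_algebra.
From mathcomp Require Export mpoly.

Set Implicit Arguments.
Unset Strict Implicit.
Unset Printing Implicit Defensive.

Import GRing.Theory.
Local Open Scope ring_scope.

(* [ideal_gen P g p] : p is in the ideal generated by the g i such that P i. *)
Definition ideal_gen (R : comNzRingType) (I : finType) (P : pred I) (g : I -> R)
    (p : R) : Prop :=
  exists c : I -> R, p = \sum_(i | P i) c i * g i.

Lemma ideal_gen_sub (R : comNzRingType) (I J : finType) (P : pred I) (Q : pred J)
    (g : I -> R) (h : J -> R) (p : R) :
  (forall i, P i -> exists a j, Q j /\ g i = a * h j) ->
  ideal_gen P g p -> ideal_gen Q h p.
Proof.
move=> gh [c ->]; apply: (big_ind (ideal_gen Q h)) => [|x y [a ->] [b ->]|i Pi].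
- by exists (fun=> 0); rewrite big1 // => j _; rewrite mul0r.
- exists (fun j => a j + b j); rewrite -big_split.
  by apply: eq_bigr => j _; rewrite mulrDl.
have [a [j [Qj ->]]] := gh i Pi.
exists (fun k => if k == j then c i * a else 0).
rewrite (bigD1 j) //= eqxx big1 ?addr0 ?mulrA // => k /andP[_ /negPf ->].
by rewrite mul0r.
Qed.

(* The set of faces of Delta(G), for the graph G = (V, e). *)
Definition indep_complex (V : finType) (e : rel V) : {set {set V}} :=
  [set W : {set V} | [forall u in W, forall v in W, ~~ e u v]].

(* Variables of mpoly are indexed by ordinals, so the vertex v is the variable
   of index enum_rank v. *)
Definition vvar (V : finType) (K : fieldType) (v : V) : {mpoly K[#|V|]} :=
  'X_(enum_rank v).

Definition edge_ideal (V : finType) (e : rel V) (K : fieldType) :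
    {mpoly K[#|V|]} -> Prop :=
  ideal_gen (fun uv : V * V => e uv.1 uv.2)
            (fun uv => vvar K uv.1 * vvar K uv.2).

(* The Stanley-Reisner ring K[D] is the quotient of {mpoly K[#|V|]} by this
   ideal. *)
Definition sr_ideal (V : finType) (D : {set {set V}}) (K : fieldType) :
    {mpoly K[#|V|]} -> Prop :=
  ideal_gen (fun W : {set V} => W \notin D) (fun W => \prod_(v in W) vvar K v).

(* K[Delta(G)] = K(G) / I(G) *)
Lemma sr_ideal_indep_complex (V : finType) (e : rel V) (K : fieldType)
    (e_irr : irreflexive e) (p : {mpoly K[#|V|]}) :
  sr_ideal (indep_complex e) p <-> edge_ideal e p.
Proof.
have neq_e u v : e u v -> v != u by apply: contraTneq => ->; rewrite e_irr.
split; apply: ideal_gen_sub.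
  move=> W; rewrite inE negb_forall_in => /exists_inP[u uW].
  rewrite negb_forall_in => /exists_inP[v vW]; rewrite negbK => uv.
  exists (\prod_(w in W | (w != u) && (w != v)) vvar K w), (u, v); split=> //=.
  rewrite (bigD1 u uW) /= (bigD1 v) /=; last by rewrite neq_e // andbT.
  rewrite mulrA mulrC.
  by congr (_ * _); apply: eq_bigl => w; rewrite andbA.
move=> [u v] /= uv; exists 1, [set u; v]; split.
  rewrite inE negb_forall_in; apply/exists_inP; exists u; first by rewrite !inE eqxx.
  rewrite negb_forall_in; apply/exists_inP; exists v; last by rewrite negbK.
  by rewrite !inE eqxx orbT.
by rewrite mul1r big_setU1 ?big_set1 // inE eq_sym neq_e.
Qed.

(* Minimal graded free resolutions
     ... -> F_2 -> F_1 -> F_0 -> R/I -> 0,     R = {mpoly K[n]},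
   of the quotient of R by a homogeneous ideal I, with all F_i of finite rank.
   F_i is the module of row vectors over R with one coordinate for each element
   of [shifts i]; a shift d stands for a summand R(-d), whose basis element has
   degree d.  Maps act on row vectors on the right, and F_0 -> R/I is given by
   representatives in R of the images of the basis elements. *)

(* [homog_from_to a b p] : p is homogeneous of degree b - a (so p = 0 when
   b < a), that is, multiplication by p is a degree 0 map R(-b) -> R(-a). *)
Definition homog_from_to (n : nat) (K : fieldType) (a b : nat)
    (p : {mpoly K[n]}) : Prop :=
  forall m : 'X_{1..n}, m \in msupp p -> (mdeg m + a)%N = b.

Record min_graded_resolution (n : nat) (K : fieldType)
    (I : {mpoly K[n]} -> Prop) := MinGradedResolution {
  shifts : nat -> seq nat;
  res_aug : 'cV[{mpoly K[n]}]_(size (shifts 0));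
  res_diff : forall i : nat,
    'M[{mpoly K[n]}]_(size (shifts i.+1), size (shifts i));
  res_aug_homog : forall j : 'I_(size (shifts 0)),
    homog_from_to 0 (nth 0%N (shifts 0) j) (res_aug j 0);
  res_diff_homog : forall i (j : 'I_(size (shifts i.+1)))
      (k : 'I_(size (shifts i))),
    homog_from_to (nth 0%N (shifts i) k) (nth 0%N (shifts i.+1) j)
                  (res_diff i j k);
  res_aug_surj : forall p : {mpoly K[n]},
    exists v : 'rV_(size (shifts 0)), I (p - (v *m res_aug) 0 0);
  res_aug_exact : forall v : 'rV_(size (shifts 0)),
    I ((v *m res_aug) 0 0) <-> exists w, v = w *m res_diff 0;
  res_diff_exact : forall i (v : 'rV_(size (shifts i.+1))),
    v *m res_diff i = 0 <-> exists w, v = w *m res_diff i.+1;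
  (* the image of F_i.+1 lies in (X_0, ..., X_n.-1) F_i *)
  res_minimal : forall i j k, (res_diff i j k)@_0%MM = 0
}.

Definition graded_betti (n : nat) (K : fieldType) (I : {mpoly K[n]} -> Prop)
    (F : min_graded_resolution I) (i d : nat) : nat :=
  count_mem d (shifts F i).

(* The sum over all d of graded_betti F i d; the other d contribute 0. *)
Definition betti (n : nat) (K : fieldType) (I : {mpoly K[n]} -> Prop)
    (F : min_graded_resolution I) (i : nat) : nat :=
  (\sum_(d <- undup (shifts F i)) graded_betti F i d)%N.

(* Main.v *)
(* Let R = K[x_1, ..., x_n] and let I be the edge ideal.  The zigzag of the double
   complex (minimal resolution) x (Koszul complex) identifies K^(beta_i) with the
   i-th Koszul homology of R/I.  That homology lives in squarefree multidegrees W,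
   where it is the reduced cohomology of the independence complex of G[W] in
   degree |W| - i - 1 (Hochster).  Call its dimension b_i(W): it suffices to show
   that each b_i(W) with i <= 5 does not depend on the field, by induction on i.

   For a vertex v there is a long exact sequence relating b_i(W) to b_{i-1}(W - v)
   and b_{i - deg v}(W - N[v]).  If N(u) is contained in N[v] for some u <> v, then
   the connecting maps vanish and induction applies.  Otherwise all degrees are at
   least 2.  Moreover b_i(W) = 0 when |W| > 2i, or when |W| = 2i and W is not a
   perfect induced matching.  The case |W| = i + 1 counts connected components and
   |W| = i + 2 then follows from the Euler characteristic.  For |W| >= i + 3 these
   vanishing results kill the connecting maps at some v, except when i = 5,
   |W| = 8 and all degrees are 2 or 3; there, for a suitable path p - u - q with
   deg u = 2, one finds b_5(W - p) = 0, which kills the maps at p. *)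

Require Import Defs.
From HB Require Import structures.
From mathcomp Require Import all_boot all_order all_algebra.
From mathcomp Require Import zify.

Set Implicit Arguments.
Unset Strict Implicit.
Unset Printing Implicit Defensive.

Import GRing.Theory.
Local Open Scope ring_scope.

(** * Koszul differentials *)

(** Complexes over two fields admit no map between them, so only dimensions can be compared. The
    long exact sequence is therefore kept as equations and inequalities between numbers, in which
    the ranks of the connecting maps are the only terms that induction does not control. For #|W| >=
    i + 3 the reductions aim at making these ranks zero over every field at once. Cohomology of
    faces F of G[W] is computed on the complements S = W - F, because the part of multidegree W of
    the Koszul complex of R/I has the basis X^(W - S) e_S with W - S a face. The topological complex
    and the Koszul complex then share one differential, which removes points from S. The bound 5
    enters twice. With #|W| >= i + 3 and a vertex v of degree d >= 2, the set W - N[v] has more than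
    2(i - 1 - d) vertices as soon as i < d + 4. And the range i + 3 <= #|W| <= 2i - 2, which the
    counting arguments leave open, contains for i <= 5 only the case i = 5, #|W| = 8. *)

Section Koszul.
Variables (n : nat) (A : comNzRingType) (M : lmodType A).
Implicit Types (s t u v : 'I_n) (S T : {set 'I_n}) (f g : {ffun {set 'I_n} -> M}).

Definition set_sign s T : bool := odd #|[set t in T | (t < s)%N]|.

Lemma set_signU1 s t T : t \notin T -> set_sign s (t |: T) = (t < s)%N (+) set_sign s T.
Proof.
move=> tT; rewrite /set_sign; have [ts|ts] := boolP (t < s)%N.
  have -> : [set t0 in t |: T | (t0 < s)%N] = t |: [set t0 in T | (t0 < s)%N].
    by apply/setP=> w; rewrite !inE; case: eqVneq => // ->; rewrite ts.
  by rewrite cardsU1 inE (negPf tT) /= oddD.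
congr (odd #|pred_of_set _|); apply/setP=> w; rewrite !inE.
by case: eqVneq => // ->; rewrite (negPf ts) !andbF.
Qed.

Lemma set_sign_swap s t T : s != t -> s \notin T -> t \notin T ->
  set_sign s T (+) set_sign t (s |: T) = ~~ (set_sign t T (+) set_sign s (t |: T)).
Proof.
move=> st sT tT; rewrite !set_signU1 //.
by case: (ltngtP s t) => [||/val_inj /eqP]; rewrite ?(negPf st) //;
  case: (set_sign s T); case: (set_sign t T).
Qed.

(** With f read as the sum of the [f S] e_S, this is the Koszul differential sending e_S to the
    signed sum of the [a s] e_(S - s), written as the coefficient at T. *)
Definition koszul (a : 'I_n -> A) f : {ffun {set 'I_n} -> M} :=
  [ffun T : {set 'I_n} => \sum_(s | s \notin T) ((-1) ^+ set_sign s T * a s) *: f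
    (s |: T)].

Lemma koszul_is_linear a : linear (koszul a).
Proof.
move=> c f g; apply/ffunP=> T; rewrite !ffunE scaler_sumr -big_split /=.
by apply: eq_bigr => s _; rewrite !ffunE scalerDr !scalerA [_ * c]mulrC.
Qed.

HB.instance Definition _ a :=
  GRing.isLinear.Build A {ffun {set 'I_n} -> M} {ffun {set 'I_n} -> M} _ (koszul a)
    (koszul_is_linear a).

Lemma koszul_koszul a f : koszul a (koszul a f) = 0.
Proof.
apply/ffunP=> T; rewrite !ffunE.
pose F s t := ((-1) ^+ set_sign s T * a s * ((-1) ^+ set_sign t (s |: T) * a t)) *: f
  (t |: (s |: T)).
have FC s t : s != t -> s \notin T -> t \notin T -> F s t = - F t s.
  move=> st sT tT; rewrite /F -scaleNr setUCA; congr (_ *: _).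
  rewrite !(mulrACA _ (a _)) -!signr_addb (set_sign_swap st) // signrN.
  by rewrite mulNr [a s * _]mulrC.
transitivity (\sum_(s | s \notin T) \sum_(t | (t \notin T) && (t != s)) F s t).
  apply: eq_bigr => s sT; rewrite ffunE scaler_sumr.
  by apply: eq_big => [t|t _]; rewrite ?scalerA // !inE negb_or andbC.
(* Each unordered pair occurs in both orders; once the sums of the second half are exchanged, the
   two occurrences cancel by [FC]. *)
transitivity (\sum_(s | s \notin T) \sum_(t | (t \notin T) && (t < s)%N) F s t +
              \sum_(s | s \notin T) \sum_(t | (t \notin T) && (s < t)%N) F s t).
  rewrite -big_split; apply: eq_bigr => s sT /=.
  rewrite (bigID (fun t : 'I_n => (t < s)%N)) /=; congr (_ + _); apply: eq_bigl => t;
    rewrite -andbA; case: (t \notin T) => //=; rewrite -val_eqE /=; by case: ltngtP.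
rewrite [X in _ + X](exchange_big_dep (fun s => s \notin T)) /=; last first.
  by move=> s t _ /andP[].
rewrite -big_split big1 //= => s sT.
rewrite [X in _ + X](eq_bigl (fun t => (t \notin T) && (t < s)%N)); last first.
  by move=> t; rewrite sT.
rewrite -big_split big1 //= => t /andP[tT ts].
by rewrite (FC s t) ?addNr // -val_eqE neq_ltn ts orbT.
Qed.

(* Contracting homotopy in the direction v; q plays the role of division by a v. *)
Definition koszul_htpy (q : M -> M) v f : {ffun {set 'I_n} -> M} :=
  [ffun T : {set 'I_n} => if v \in T then (-1) ^+ set_sign v (T :\ v) *: q (f (T :\ v))
    else 0].

(** For v in T the terms with s != v cancel in pairs, since q commutes with the other coefficients,
    and s = v leaves [f T]. For v outside T only s = v survives. The two uses are all coefficients 1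
    with q the identity, and variables with q the division by one of them. *)
Lemma koszul_htpyE (a : 'I_n -> A) (q : {additive M -> M}) v f T :
    (forall s (c : M), s != v -> q (a s *: c) = a s *: q c) ->
    (forall c : M, q (a v *: c) = c) ->
  koszul a (koszul_htpy q v f) T + koszul_htpy q v (koszul a f) T =
    if v \in T then f T else a v *: q (f T).
Proof.
move=> qa qv.
have qs (b : bool) (c : M) : q ((-1) ^+ b *: c) = (-1) ^+ b *: q c.
  by case: b; rewrite ?expr1 ?expr0 ?scale1r // !scaleN1r raddfN.
rewrite /koszul !ffunE; case: ifPn => vT; last first.
  rewrite addr0 (bigD1 v) //= ffunE !inE eqxx /= setU1K // big1 ?addr0.
    by rewrite scalerA mulrAC -expr2 sqrr_sign mul1r.
  move=> s /andP[sT sv]; rewrite ffunE !inE (negPf vT) eq_sym (negPf sv) /=.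
  by rewrite scaler0.
set T' := T :\ v.
have defT : T = v |: T' by rewrite setD1K.
have vT' : v \notin T' by rewrite !inE eqxx.
rewrite [in RHS]defT (bigD1 v (P := fun s => s \notin T')) //= raddfD scalerDr.
rewrite addrC -addrA raddf_sum scaler_sumr.
rewrite -scalerA qs qv scalerA -expr2 sqrr_sign scale1r.
rewrite [X in _ + (X + _)](eq_bigl (fun s => s \notin T)); last first.
  by move=> s; rewrite !inE negb_and negbK; case: (eqVneq s v) => [->|_] /=;
    rewrite ?vT ?andbT.
rewrite -big_split big1 ?addr0 //= => s sT.
have sv : s != v by apply: contraNneq sT => ->.
have sT' : s \notin T' by rewrite !inE negb_and sT orbT.
rewrite ffunE !inE vT orbT.
have -> : (s |: T) :\ v = s |: T'.
  by apply/setP=> w; rewrite /T' !inE; case: (eqVneq w s) => [->|_] /=; rewrite ?sv.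
have sgE : set_sign s T (+) set_sign v (s |: T') = ~~ (set_sign v T' (+) set_sign s T').
  have := set_sign_swap sv sT' vT'; rewrite -defT.
  by case: (set_sign s T); case: (set_sign s T'); case: (set_sign v T');
    case: (set_sign v _).
rewrite -!scalerA qs qa // !scalerA -scalerDl.
rewrite [X in _ + X]mulrAC -!signr_addb sgE signrN mulNr subrr.
by rewrite scale0r.
Qed.
End Koszul.
(** * Homology of families of finite sets *)

Section FamilyHomology.
Variables (n : nat) (K : fieldType).
Implicit Types (s t u v : 'I_n) (S T X : {set 'I_n}) (P Q L U : pred {set 'I_n}).
Local Notation N := #|{set 'I_n}|.

(** The Koszul differential with all coefficients 1, acting on row vectors. It is indexed by all
    subsets, so that every family and every degree is cut out of one matrix by diagonal
    projections. *)
Definition bdmx : 'M[K]_N :=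
  let F S T : K := \sum_(s | s \notin T) ((S == s |: T)%:R * (-1) ^+ set_sign s T) in
  \matrix_(a, b) F (enum_val a) (enum_val b).

Definition prmx P : 'M[K]_N := diag_mx (\row_b (P (enum_val b))%:R).

Definition lay P i : pred {set 'I_n} := [pred S | P S && (#|S| == i)].

Fact fbdmx_key : unit. Proof. by []. Qed.
(* Locked: rewriting with mulmxA must not see through fbdmx. *)
Definition fbdmx : pred {set 'I_n} -> 'M[K]_N :=
  locked_with fbdmx_key (fun P => prmx P *m bdmx *m prmx P).
Lemma fbdmxE P : fbdmx P = prmx P *m bdmx *m prmx P.
Proof. by rewrite /fbdmx locked_withE. Qed.
Definition lay_bdmx P i : 'M[K]_N := prmx (lay P i) *m fbdmx P.
Definition bd_rank P i : nat := \rank (lay_bdmx P i).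
Definition lay_card P i : nat := #|[set S | lay P i S]|.
(* Degree i homology of the complex spanned by P, whose boundary removes points
   one at a time; for convex P the subtractions do not truncate (bd_rank_le). *)
Definition hdim P i : nat := (lay_card P i - bd_rank P i - bd_rank P i.+1)%N.

Definition convex P := forall S T X, S \subset T -> T \subset X -> P S -> P X -> P T.

Lemma prmxAprmxE P Q (B : 'M[K]_N) a b :
  (prmx P *m B *m prmx Q) a b = (P (enum_val a))%:R * B a b * (Q (enum_val b))%:R.
Proof. by rewrite /prmx mul_mx_diag mxE mul_diag_mx !mxE. Qed.

Lemma prmxM P Q : prmx P *m prmx Q = prmx (predI P Q).
Proof.
rewrite /prmx mulmx_diag; congr diag_mx; apply/rowP=> b; rewrite !mxE /=.
by rewrite -natrM mulnb.
Qed.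

Lemma eq_prmx P Q : P =1 Q -> prmx P = prmx Q.
Proof. by move=> PQ; congr diag_mx; apply/rowP=> b; rewrite !mxE PQ. Qed.

Lemma prmxMr P Q : {subset P <= Q} -> prmx P *m prmx Q = prmx P.
Proof. by move=> PQ; rewrite prmxM; apply: eq_prmx => S /=; rewrite andb_idr //;
  exact: PQ. Qed.

Lemma prmxMl P Q : {subset Q <= P} -> prmx P *m prmx Q = prmx Q.
Proof. by move=> QP; rewrite prmxM; apply: eq_prmx => S /=; rewrite andb_idl //;
  exact: QP. Qed.

Lemma prmxD P Q (R : pred {set 'I_n}) : (forall S, (P S + Q S)%N = R S) -> prmx P +
  prmx Q = prmx R.
Proof.
move=> PQ; rewrite /prmx -raddfD; congr diag_mx; apply/rowP=> b; rewrite !mxE.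
by rewrite -natrD PQ.
Qed.

Lemma prmx0 P : P =1 xpred0 -> prmx P = 0.
Proof.
move=> P0; apply/matrixP=> a b; rewrite /prmx !mxE P0.
by rewrite mul0rn.
Qed.

(** A sum of matrices of rank one gives the upper bound, for P and for its complement. The two
    projections add up to the identity, so both bounds are sharp. *)
Lemma rank_prmx P : \rank (prmx P) = #|[set S | P S]|.
Proof.
have le Q : (\rank (prmx Q) <= #|[set S | Q S]|)%N.
  have -> : prmx Q = \sum_(S | Q S) delta_mx (enum_rank S) (enum_rank S).
    apply/row_matrixP=> a; apply/rowP=> b; rewrite !mxE summxE.
    rewrite -(enum_valK a) -(enum_valK b); move: (enum_val a) (enum_val b) => S T.
    rewrite enum_rankK (inj_eq enum_rank_inj).
    have [<-|ST] := eqVneq S T; last first.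
      rewrite mulr0n big1 // => X _; rewrite mxE !(inj_eq enum_rank_inj).
      by have [<-|] := eqVneq S X; rewrite //= eq_sym (negPf ST).
    rewrite mulr1n.
    have [QS|QS] := boolP (Q S).
      rewrite (bigD1 S) //= mxE !eqxx big1 ?addr0 // => X /andP[_ XS].
      by rewrite mxE (inj_eq enum_rank_inj) eq_sym (negPf XS).
    rewrite big1 // => X QX; rewrite mxE (inj_eq enum_rank_inj).
    by have [SX|//] := eqVneq S X; rewrite SX QX in QS.
  rewrite -[X in (_ <= X)%N]sum1_card [X in (_ <= X)%N](eq_bigl Q) => [|S];
    last by rewrite inE.
  elim/big_rec2: _ => [|S k B QS Bk]; rewrite ?mxrank0 //.
  by rewrite (leq_trans (mxrank_add _ _)) // mxrank_delta leq_add2l.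
apply/eqP; rewrite eqn_leq le /= -(leq_add2r #|[set S | ~~ P S]|).
apply: leq_trans (_ : (\rank (prmx P + prmx (predC P))%R <= _)%N).
  rewrite (@prmxD P (predC P) predT) => [|S /=]; last by case: (P S).
  rewrite (_ : prmx predT = 1%:M) ?mxrank1; last first.
    by rewrite /prmx -diag_const_mx; congr diag_mx; apply/rowP=> b; rewrite !mxE.
  rewrite -(cardC [set S | P S]) leq_add2l subset_leq_card //.
  by apply/subsetP=> S; rewrite !inE.
by rewrite (leq_trans (mxrank_add _ _)) // leq_add2l le.
Qed.

Lemma bdmx_neq0 a b : bdmx a b != 0 -> exists2 s, s \notin (enum_val b : {set 'I_n}) &
  enum_val a = s |: enum_val b.
Proof.
rewrite mxE => nz.
have [s /andP[sb /eqP->]|no] := pickP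
  (fun s => (s \notin enum_val b) && (enum_val a == s |: enum_val b)).
  by exists s.
case/eqP: nz; apply: big1 => s sb; have := no s; rewrite /= sb => /= ->.
by rewrite mul0r.
Qed.

Lemma eq_prmx_bdmx P Q P' Q' :
  (forall s T, s \notin T -> P (s |: T) && Q T = P' (s |: T) && Q' T) ->
  prmx P *m bdmx *m prmx Q = prmx P' *m bdmx *m prmx Q'.
Proof.
move=> PQ; apply/matrixP=> a b; rewrite !prmxAprmxE.
have [->|/bdmx_neq0[s sb ->]] := eqVneq (bdmx a b) 0; first by rewrite !mulr0 !mul0r.
by rewrite mulrAC -natrM mulnb PQ // -mulnb natrM mulrAC.
Qed.

Definition ffun_row (x : 'rV[K]_N) : {ffun {set 'I_n} -> K^o} :=
  [ffun S => x 0 (enum_rank S)].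

Lemma ffun_row_inj : injective ffun_row.
Proof.
move=> x y /ffunP xy; apply/rowP=> b; have := xy (enum_val b).
by rewrite !ffunE enum_valK.
Qed.

Lemma row_bdmx x : ffun_row (x *m bdmx) = koszul (fun=> 1) (ffun_row x).
Proof.
apply/ffunP=> T; rewrite !ffunE mxE.
under eq_bigr => a _ do rewrite mxE enum_rankK mulr_sumr.
rewrite exchange_big; apply: eq_bigr => s sT /=.
rewrite (bigD1 (enum_rank (s |: T))) //= enum_rankK eqxx mul1r big1 ?addr0.
  by rewrite ffunE mulr1 mulrC.
move=> a; rewrite -{1}(enum_valK a) (inj_eq enum_rank_inj) => /negPf->.
by rewrite mul0r mulr0.
Qed.

Lemma bdmx_bdmx : bdmx *m bdmx = 0.
Proof.
apply/row_matrixP=> i; rewrite row0 row_mul; apply: ffun_row_inj.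
by rewrite !row_bdmx rowE row_bdmx koszul_koszul; apply/ffunP=> S; rewrite !ffunE mxE.
Qed.

Definition htpymx v : 'M[K]_N :=
  let F S T : K := if v \in T then (S == T :\ v)%:R * (-1) ^+ set_sign v (T :\ v) else
    0 in
  \matrix_(a, b) F (enum_val a) (enum_val b).

Lemma row_htpymx v x : ffun_row (x *m htpymx v) = koszul_htpy idfun v (ffun_row x).
Proof.
apply/ffunP=> T; rewrite !ffunE mxE.
under eq_bigr => a _ do rewrite mxE enum_rankK.
case: ifP => vT; last by rewrite big1 // => a _; rewrite mulr0.
rewrite (bigD1 (enum_rank (T :\ v))) //= enum_rankK eqxx mul1r big1 ?addr0.
  by rewrite mulrC.
move=> a; rewrite -{1}(enum_valK a) (inj_eq enum_rank_inj) => /negPf->.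
by rewrite mul0r mulr0.
Qed.

Lemma bdmx_htpymx v : bdmx *m htpymx v + htpymx v *m bdmx = 1%:M.
Proof.
apply/row_matrixP=> i; rewrite !rowE mulmxDr mulmx1 !mulmxA; apply: ffun_row_inj.
set x := delta_mx _ _; have -> y z : ffun_row (y + z) = ffun_row y + ffun_row z.
  by apply/ffunP=> S; rewrite !ffunE mxE.
apply/ffunP=> T; rewrite row_htpymx !row_bdmx row_htpymx addrC ffunE.
rewrite (koszul_htpyE (q := idfun) (v := v)); last by move=> c /=; rewrite scale1r.
  by rewrite /= scale1r if_same.
by move=> s c _ /=; rewrite !scale1r.
Qed.

Lemma prmx_fbdmx P : prmx P *m fbdmx P = fbdmx P.
Proof. by rewrite !fbdmxE !mulmxA prmxMr. Qed.

Lemma fbdmx_prmx P : fbdmx P *m prmx P = fbdmx P.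
Proof. by rewrite !fbdmxE -!mulmxA prmxMr. Qed.

Lemma prmxC P : prmx P + prmx (predC P) = 1%:M.
Proof.
rewrite (@prmxD P (predC P) predT) => [|S /=]; last by case: (P S).
by rewrite /prmx -diag_const_mx; congr diag_mx; apply/rowP=> b; rewrite !mxE.
Qed.

(** Two successive removals between members of P pass, by convexity, through a member of P, so
    truncation to P loses no term of [bdmx *m bdmx]. *)
Lemma fbdmx_fbdmx P : convex P -> fbdmx P *m fbdmx P = 0.
Proof.
move=> cP.
have E0 : (prmx P *m bdmx *m prmx (predC P)) *m (prmx (predC P) *m bdmx *m prmx P) = 0.
  apply/matrixP=> a b; rewrite !mxE big1 // => c _; rewrite !prmxAprmxE.
  have [->|/bdmx_neq0[s sc ac]] := eqVneq (bdmx a c) 0.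
    by rewrite mulr0 !mul0r.
  have [->|/bdmx_neq0[t tb cb]] := eqVneq (bdmx c b) 0.
    by rewrite mulr0 !mul0r mulr0.
  have [Pa|_] := boolP (P (enum_val a)); last by rewrite !mul0r.
  have [Pb|_] := boolP (P (enum_val b)); last by rewrite !mulr0.
  rewrite /= (_ : P (enum_val c)) /= ?mul0r ?mulr0 ?mul0r //.
  by apply: cP Pb Pa; rewrite ?ac ?subsetUr // cb subsetUr.
have : (prmx P *m bdmx) *m (prmx P + prmx (predC P)) *m (bdmx *m prmx P) = 0.
  by rewrite prmxC mulmx1 mulmxA -(mulmxA _ bdmx bdmx) bdmx_bdmx mulmx0 mul0mx.
rewrite mulmxDr mulmxDl -(@prmxMr (predC P) (predC P)) // => <-.
rewrite -[X in _ + X]mulmxA; move: E0; rewrite !mulmxA => ->; rewrite addr0.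
by rewrite !fbdmxE !mulmxA -(mulmxA _ (prmx P) (prmx P)) prmxMr.
Qed.

Lemma lay_fbdmx P i : prmx (lay P i.+1) *m fbdmx P = fbdmx P *m prmx (lay P i).
Proof.
rewrite !fbdmxE !mulmxA prmxMr => [|S /andP[]//];
  rewrite -[RHS]mulmxA prmxMl => [|S /andP[]//].
apply: eq_prmx_bdmx => s T sT; rewrite /lay /= cardsU1 sT add1n eqSS.
by rewrite -andbA [(_ == _) && _]andbC.
Qed.

Lemma lay_bdmx0 P : lay_bdmx P 0 = 0.
Proof.
rewrite /lay_bdmx !fbdmxE !mulmxA prmxMr => [|S /andP[]//].
rewrite (@eq_prmx_bdmx _ _ pred0 pred0) => [|s T sT]; rewrite ?/lay /=;
  first by rewrite prmx0 // !mul0mx.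
by rewrite cardsU1 sT andbF.
Qed.

Lemma lay_bdmx_lay P i : lay_bdmx P i.+1 *m prmx (lay P i) = lay_bdmx P i.+1.
Proof. by rewrite /lay_bdmx lay_fbdmx -mulmxA prmxMr. Qed.

Lemma rank_ker_lay P i (B : 'M[K]_N) :
  (\rank (prmx (lay P i) *m B) + \rank (prmx (lay P i) :&: kermx B)%MS)%N = lay_card P
    i.
Proof. by rewrite mxrank_mul_ker rank_prmx. Qed.

Lemma lay_bdmx_ker P i : convex P ->
  (lay_bdmx P i.+1 <= prmx (lay P i) :&: kermx (fbdmx P))%MS.
Proof.
move=> cP; rewrite sub_capmx -{1}lay_bdmx_lay submxMl /=.
by apply/sub_kermxP; rewrite /lay_bdmx -mulmxA fbdmx_fbdmx // mulmx0.
Qed.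

Lemma bd_rank_le P i : convex P -> (bd_rank P i + bd_rank P i.+1 <= lay_card P i)%N.
Proof.
move=> cP; rewrite -(rank_ker_lay P i (fbdmx P)) leq_add2l.
exact: mxrankS (lay_bdmx_ker i cP).
Qed.

Lemma rank_adds_coker m1 m2 m (A : 'M[K]_(m1, m)) (B : 'M_(m2, m)) :
  (\rank (A + B)%MS <= \rank A + \rank (B *m cokermx A))%N.
Proof.
rewrite -(mxrank_mul_ker _ (cokermx A)) addnC leq_add //.
  rewrite (leq_trans (mxrankS (capmxSr _ _))) // mxrank_ker mxrank_coker.
  by have := rank_leq_col A; lia.
rewrite mxrankS // addsmxMr addsmx_sub submx_refl andbT.
by rewrite mulmx_coker sub0mx.
Qed.

(** * Long exact sequence of a subcomplex and its quotient *)

Section Split.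
Variables P U : pred {set 'I_n}.
Hypothesis cP : convex P.
Hypothesis UP : {subset U <= P}.
Hypothesis Uup : forall S T, S \subset T -> U S -> P T -> U T.
Let L : pred {set 'I_n} := [pred S | P S && ~~ U S].

Let LE S : L S = P S && ~~ U S. Proof. by []. Qed.
Let UP' S : U S -> P S. Proof. exact: UP. Qed.
Let LP : {subset L <= P}. Proof. by move=> S /andP[]. Qed.
Let lu : prmx L + prmx U = prmx P.
Proof.
apply: prmxD => S; rewrite LE; case: (boolP (U S)) => [/UP' ->|_] //=.
by rewrite andbT addn0.
Qed.
(** The boundary removes points and U is closed upwards in P, so no boundary leads from L into U: L
    spans a subcomplex, and U the quotient. *)
Let lDu : prmx L *m fbdmx P *m prmx U = 0.
Proof.
rewrite !fbdmxE !mulmxA prmxMr // -(mulmxA _ (prmx P)) prmxMl //.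
rewrite (@eq_prmx_bdmx _ _ pred0 pred0) => [|s T sT]; rewrite ?/lay /=;
  first by rewrite prmx0 // !mul0mx.
apply/negP=> /andP[]; rewrite LE => /andP[PS /negP US] UT; apply: US.
exact: Uup (subsetUr _ _) UT PS.
Qed.
Let dL : fbdmx L = prmx L *m fbdmx P.
Proof.
rewrite -(fbdmx_prmx P) -lu mulmxDr mulmxDr [X in _ + X]mulmxA lDu addr0 !fbdmxE
  !mulmxA prmxMr //.
by rewrite -(mulmxA _ (prmx P)) prmxMl.
Qed.
Let dU : fbdmx U = prmx U *m fbdmx P *m prmx U.
Proof. by rewrite !fbdmxE !mulmxA prmxMr // -(mulmxA _ (prmx P)) prmxMl. Qed.
Let dPu : fbdmx P *m prmx U = fbdmx U.
Proof. by rewrite dU -(prmx_fbdmx P) -{1}lu mulmxDl mulmxDl lDu add0r prmx_fbdmx. Qed.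

Let layE (Q : pred {set 'I_n}) i S : lay Q i S = Q S && (#|S| == i). Proof. by []. Qed.
Let layL i : prmx (lay L i) = prmx L *m prmx (lay P i).
Proof. by rewrite prmxM; apply: eq_prmx => S; rewrite /= !layE LE; case: (P S);
  case: (U S). Qed.
Let layU i : prmx (lay U i) = prmx U *m prmx (lay P i).
Proof.
by rewrite prmxM; apply: eq_prmx => S; rewrite /= !layE;
  case: (boolP (U S)) => //= /UP' ->.
Qed.
Let layLr i : prmx (lay L i) = prmx (lay P i) *m prmx L.
Proof. by rewrite layL !prmxM; apply: eq_prmx => S /=; rewrite andbC. Qed.
Let layUr i : prmx (lay U i) = prmx (lay P i) *m prmx U.
Proof. by rewrite layU !prmxM; apply: eq_prmx => S /=; rewrite andbC. Qed.

Lemma lay_bdmx_quot i : lay_bdmx P i *m prmx U = lay_bdmx U i.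
Proof.
by rewrite /lay_bdmx -mulmxA dPu -{1}(prmx_fbdmx U) mulmxA -layUr.
Qed.

Lemma lay_bdmx_sub i : lay_bdmx L i = prmx L *m lay_bdmx P i.
Proof. by rewrite /lay_bdmx dL mulmxA layLr -!mulmxA [prmx L *m (prmx L *m _)]mulmxA
  prmxMr // mulmxA -layLr layL mulmxA. Qed.

Lemma rank_split i : bd_rank P i =
  (bd_rank U i + \rank (lay_bdmx P i :&: kermx (prmx U))%MS)%N.
Proof. by rewrite /bd_rank -(mxrank_mul_ker (lay_bdmx P i) (prmx U)) lay_bdmx_quot. Qed.

Lemma lay_card_split i : lay_card P i = (lay_card L i + lay_card U i)%N.
Proof.
rewrite /lay_card -!sum1_card (bigID [pred S | U S]) addnC /=.
congr (_ + _)%N; apply: eq_bigl => S; rewrite !inE /= !layE ?LE.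
  by case: (boolP (U S)) => [/UP'->|_]; rewrite ?andbF ?andbT.
by case: (boolP (U S)) => [/UP'->|_]; rewrite ?andbF ?andbT.
Qed.

Let lu0 : prmx L *m prmx U = 0.
Proof. by rewrite prmxM prmx0 // => S; rewrite /= LE; case: (U S); rewrite ?andbF. Qed.

Let cL : convex L.
Proof.
move=> S T X ST TX /andP[PS US] /andP[PX UX]; apply/andP; split; first exact: cP PS PX.
by apply: contra UX => UT; apply: Uup UT PX.
Qed.

Let cU : convex U.
Proof.
move=> S T X ST TX US UX; apply: (Uup ST) => //.
by apply: cP ST TX _ _; apply: UP'.
Qed.

(** The dimension of the space of boundaries of P, from layer i, that lie in the span of L. Modulo
    the boundaries of L this space is the image of the connecting map, whose rank is therefore
    [R i - bd_rank L i]. *)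
Let R i := \rank (lay_bdmx P i :&: kermx (prmx U))%MS.

Let R_ge i : (bd_rank L i <= R i)%N.
Proof.
rewrite mxrankS // sub_capmx lay_bdmx_sub submxMl /=; apply/sub_kermxP.
by rewrite -(mulmxA (prmx L)) lay_bdmx_quot /lay_bdmx mulmxA layU mulmxA lu0 !mul0mx.
Qed.

Let R_le i : (R i.+1 + bd_rank L i <= lay_card L i)%N.
Proof.
rewrite -(rank_ker_lay L i (fbdmx L)) addnC leq_add2l mxrankS //.
set Y := (_ :&: _)%MS; have YM : (Y <= lay_bdmx P i.+1)%MS by rewrite capmxSl.
have Yu : Y *m prmx U = 0 by apply/sub_kermxP; rewrite capmxSr.
have [W YE] := submxP YM.
have Yl : Y *m prmx L = Y.
  have : Y *m (prmx L + prmx U) = Y by rewrite lu YE /lay_bdmx -!mulmxA fbdmx_prmx.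
  by rewrite mulmxDr Yu addr0.
have Yp : Y *m prmx (lay P i) = Y by rewrite YE -mulmxA lay_bdmx_lay.
have YD : Y *m fbdmx P = 0 by rewrite YE /lay_bdmx -!mulmxA fbdmx_fbdmx // !mulmx0.
rewrite sub_capmx; apply/andP; split.
  by apply/submxP; exists Y; rewrite layL mulmxA Yl Yp.
by apply/sub_kermxP; rewrite dL mulmxA Yl YD.
Qed.

(** In view of [rank_split] this bounds the connecting rank by [hdim U i]. Modulo the boundaries of
    L, the boundary of P becomes the map [B *m C] on layer i of U, and this map kills the boundaries
    of U. *)
Let R_le' i : (bd_rank P i + bd_rank U i.+1 <= bd_rank L i + lay_card U i)%N.
Proof.
set C := cokermx (lay_bdmx L i); pose B := prmx (lay U i) *m fbdmx P.
have MB : lay_bdmx P i = lay_bdmx L i + B.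
  by rewrite lay_bdmx_sub /B layU -mulmxA -/(lay_bdmx P i) -mulmxDl lu /lay_bdmx mulmxA
    prmxMl // => S /andP[].
have leM : (bd_rank P i <= bd_rank L i + \rank (B *m C))%N.
  rewrite (leq_trans _ (rank_adds_coker _ _)) // mxrankS // MB.
  by rewrite addmx_sub_adds.
have BC : B *m C = lay_bdmx P i *m C by rewrite MB mulmxDl mulmx_coker add0r.
have BC0 : lay_bdmx U i.+1 *m (fbdmx P *m C) = 0.
  have -> : lay_bdmx U i.+1 = prmx (lay U i.+1) *m fbdmx P *m prmx (lay U i).
    by rewrite -lay_bdmx_lay /lay_bdmx -dPu (layU i) !mulmxA
      -(mulmxA _ (prmx U) (prmx U)) prmxMr.
  rewrite -mulmxA [X in _ *m X]mulmxA -/B BC -!mulmxA [fbdmx P *m (_ *m _)]mulmxA.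
  by rewrite -lay_fbdmx -!mulmxA [fbdmx P *m (fbdmx P *m _)]mulmxA fbdmx_fbdmx //
    mul0mx !mulmx0.
have : (bd_rank U i.+1 + \rank (B *m C) <= lay_card U i)%N.
  rewrite -(rank_ker_lay U i (fbdmx P *m C)) [X in (_ <= \rank X + _)%N]mulmxA -/B
    addnC leq_add2l mxrankS //.
  rewrite sub_capmx -{1}lay_bdmx_lay submxMl; exact/sub_kermxP.
by move=> h; rewrite (leq_trans (leq_add leM (leqnn _))) // -addnA leq_add2l addnC.
Qed.

(* rho i is the rank of the connecting map from degree i of the quotient U to
   degree i.-1 of the subcomplex L. *)
Lemma hdim_split : exists rho : nat -> nat, forall i,
  [/\ (hdim P i + rho i + rho i.+1 = hdim L i + hdim U i)%N,
      (rho i <= hdim U i)%N & (rho i.+1 <= hdim L i)%N].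
Proof.
exists (fun i => (R i - bd_rank L i)%N) => i.
have Pi : bd_rank P i = (bd_rank U i + R i)%N := rank_split i.
have Pi1 : bd_rank P i.+1 = (bd_rank U i.+1 + R i.+1)%N := rank_split i.+1.
have := R_ge i; have := R_ge i.+1; have := R_le i; have := R_le' i.
have := bd_rank_le i cP; have := bd_rank_le i cL; have := bd_rank_le i cU.
rewrite /hdim lay_card_split Pi Pi1;
  move: (lay_card L i) (lay_card U i) (bd_rank L i) (bd_rank L i.+1).
move: (bd_rank U i) (bd_rank U i.+1) (R i) (R i.+1) => *; split; lia.
Qed.

(** With L closed upwards as well, no boundary leads from U into L. The complex is a direct sum and
    the connecting ranks are zero. *)
Lemma hdim_sum : (forall S T, S \subset T -> L S -> P T -> L T) ->
  forall i, hdim P i = (hdim L i + hdim U i)%N.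
Proof.
move=> Lup i; have uDl : prmx U *m fbdmx P *m prmx L = 0.
  rewrite !fbdmxE !mulmxA prmxMr // -(mulmxA _ (prmx P)) prmxMl //.
  rewrite (@eq_prmx_bdmx _ _ pred0 pred0) => [|s T sT];
    first by rewrite prmx0 // !mul0mx.
  apply/negP=> /andP[US LT]; have := Lup _ _ (subsetUr [set s] T) LT (UP' US).
  by rewrite LE US andbF.
have R_eq k : R k = bd_rank L k.
  apply/eqP; rewrite eqn_leq R_ge andbT mxrankS //.
  set Y := (_ :&: _)%MS; have YM : (Y <= lay_bdmx P k)%MS by rewrite capmxSl.
  have Yu : Y *m prmx U = 0 by apply/sub_kermxP; rewrite capmxSr.
  have [W YE] := submxP YM.
  have Yl : Y *m prmx L = Y.
    have : Y *m (prmx L + prmx U) = Y by rewrite lu YE /lay_bdmx -!mulmxA fbdmx_prmx.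
    by rewrite mulmxDr Yu addr0.
  have Dl : fbdmx P *m prmx L = prmx L *m fbdmx P.
    rewrite -[in LHS](prmx_fbdmx P) -[in RHS](fbdmx_prmx P) -lu mulmxDl mulmxDl uDl
      addr0.
    by rewrite mulmxDr mulmxDr [X in _ = _ + X]mulmxA lDu addr0 mulmxA.
  apply/submxP; exists W; rewrite -Yl YE /lay_bdmx -!mulmxA Dl dL layLr -!mulmxA.
  by rewrite [prmx L *m (prmx L *m _)]mulmxA prmxMr.
have := rank_split i; have := rank_split i.+1; rewrite -!/(R _) !R_eq.
have := bd_rank_le i cP; have := bd_rank_le i cL; have := bd_rank_le i cU.
rewrite /hdim lay_card_split; move: (lay_card L i) (lay_card U i) (bd_rank L i)
  (bd_rank L i.+1).
by move: (bd_rank U i) (bd_rank U i.+1) (bd_rank P i) (bd_rank P i.+1) => *; lia.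
Qed.
End Split.

(** Membership in P does not depend on v, so the homotopy in direction v commutes with the
    projection to P and contracts its complex. This is the cone argument. *)
Lemma hdim_toggle P v : convex P -> (forall S, P (v |: S) = P (S :\ v)) ->
  forall i, hdim P i = 0%N.
Proof.
move=> cP tog i.
have PH : prmx P *m htpymx v = htpymx v *m prmx P.
  rewrite /prmx mul_diag_mx mul_mx_diag; apply/matrixP=> a b; rewrite !mxE.
  move: (enum_val a) (enum_val b) => S T; case: ifP => vT; last by rewrite mulr0 mul0r.
  case: eqVneq => [->|_]; last by rewrite mul0r mulr0 mul0r.
  by rewrite mulrC -tog (setUidPr _) ?sub1set.
have DH : fbdmx P *m htpymx v + htpymx v *m fbdmx P = prmx P.
  rewrite !fbdmxE -[_ *m prmx P *m htpymx v]mulmxA PH !mulmxA -PH -!mulmxA -mulmxDr.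
  by rewrite [bdmx *m (_ *m _)]mulmxA [htpymx v *m (_ *m _)]mulmxA -mulmxDl bdmx_htpymx
    mul1mx prmxMr.
suff : (lay_card P i <= bd_rank P i + bd_rank P i.+1)%N by rewrite /hdim; lia.
rewrite -(rank_ker_lay P i (fbdmx P)) leq_add2l mxrankS //.
set Y := (_ :&: _)%MS; have Yl : (Y <= prmx (lay P i))%MS by rewrite capmxSl.
have YD : Y *m fbdmx P = 0 by apply/sub_kermxP; rewrite capmxSr.
have [W YE] := submxP Yl; apply/submxP; exists (Y *m htpymx v); rewrite -mulmxA.
have lH : prmx (lay P i) *m htpymx v = prmx (lay P i) *m htpymx v *m prmx (lay P i.+1).
  rewrite /prmx !mul_diag_mx mul_mx_diag; apply/matrixP=> a b; rewrite !mxE.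
  move: (enum_val a) (enum_val b) => S T; case: ifP => vT; last by rewrite mulr0 mul0r.
  case: eqVneq => [->|_]; last by rewrite mul0r mulr0 mul0r.
  rewrite /lay /= -tog (setUidPr _) ?sub1set // (cardsD1 v T) vT add1n eqSS.
  by case: (_ && _); rewrite ?mulr1 // !mul0r.
have YlE : Y = Y *m prmx (lay P i) by rewrite YE -mulmxA prmxMr.
have YP : Y = Y *m prmx P by rewrite {1}YlE -(@prmxMr (lay P i) P) ?mulmxA -?YlE // =>
  S /andP[].
have {1}-> : Y = Y *m htpymx v *m fbdmx P.
  by rewrite {1}YP -DH mulmxDr mulmxA YD mul0mx add0r mulmxA.
by rewrite {1}YE -(mulmxA W) lH /lay_bdmx !mulmxA -YE.
Qed.

Section Shift.
Variables (v : 'I_n) (P : pred {set 'I_n}).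
Hypothesis Pv : forall S, P S -> v \notin S.
Let P' : pred {set 'I_n} := [pred S : {set 'I_n} | (v \in S) && P (S :\ v)].
Let H := htpymx v.

(** [H] adds v to a set. Between the spans of P and P' it is inverted by [bdmx] followed by
    projection, and it commutes with the boundaries up to sign, so ranks and layer sizes agree. *)
Lemma hdim_shift1 i : hdim P' i.+1 = hdim P i.
Proof.
have HE a b : H a b != 0 -> v \in (enum_val b : {set 'I_n}) /\ enum_val a = enum_val b
  :\ v.
  rewrite mxE; case: ifP => [vb|_]; last by rewrite eqxx.
  by case: (eqVneq (enum_val a) _) => [->|_]; rewrite ?mul0r ?eqxx.
have pH (Q Q' Q1 Q1' : pred {set 'I_n}) :
    (forall T, v \in T -> Q (T :\ v) && Q' T = Q1 (T :\ v) && Q1' T) ->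
    prmx Q *m H *m prmx Q' = prmx Q1 *m H *m prmx Q1'.
  move=> QQ; apply/matrixP=> a b; rewrite !prmxAprmxE.
  have [->|/HE[vb ->]] := eqVneq (H a b) 0; first by rewrite !mulr0 !mul0r.
  by rewrite mulrAC -natrM mulnb QQ // -mulnb natrM mulrAC.
have pT : prmx predT = 1%:M.
  by rewrite -(prmxC predT) [X in _ + X]prmx0 ?addr0.
have vD T : v \notin T :\ v by rewrite !inE eqxx.
have PHP' : prmx P *m H = H *m prmx P'.
  rewrite -[LHS]mulmx1 -[H in RHS]mul1mx -!pT; apply: pH => T vT /=.
  by rewrite /P' /= vT andbT.
have Hp : H *m prmx P = 0.
  rewrite -[H]mul1mx -pT (@pH _ _ pred0 pred0) ?prmx0 ?mul0mx // => T vT /=.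
  by apply: contraTF vT => /Pv.
have p'H : prmx P' *m H = 0.
  rewrite -[LHS]mulmx1 -pT (@pH _ _ pred0 pred0) ?prmx0 ?mul0mx // => T vT /=.
  by rewrite /P' /= (negPf (vD T)).
have pp' : prmx P *m prmx P' = 0.
  by rewrite prmxM prmx0 // => S; rewrite /P' /=;
    case: (boolP (P S)) => //= /Pv /negPf ->.
have BH : bdmx *m H = 1%:M - H *m bdmx by rewrite -(bdmx_htpymx v) addrK.
have HB : H *m bdmx = 1%:M - bdmx *m H by rewrite -(bdmx_htpymx v) addrAC subrr add0r.
have pHBp : prmx P *m H *m bdmx *m prmx P = prmx P.
  rewrite -(mulmxA (prmx P)) HB mulmxBr mulmx1 mulmxBl prmxMr //.
  by rewrite -!mulmxA Hp !mulmx0 subr0.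
have p'BHp' : prmx P' *m bdmx *m H *m prmx P' = prmx P'.
  rewrite -(mulmxA (prmx P')) BH mulmxBr mulmx1 mulmxBl prmxMr //.
  by rewrite !mulmxA p'H !mul0mx subr0.
have DH : fbdmx P *m H = - (H *m fbdmx P').
  rewrite !fbdmxE -[LHS]mulmxA PHP' !mulmxA -(mulmxA (prmx P)) BH mulmxBr mulmx1
    mulmxBl pp'.
  by rewrite sub0r !mulmxA PHP'.
have lH j : prmx (lay P j) *m H = H *m prmx (lay P' j.+1).
  rewrite -[LHS]mulmx1 -[H in RHS]mul1mx -!pT; apply: pH => T vT.
  by rewrite /lay /P' /= vT andbT (cardsD1 v T) vT add1n eqSS.
have P'l j : prmx P' *m prmx (lay P' j) = prmx (lay P' j).
  by rewrite prmxMl // => S /andP[].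
have bH j : lay_bdmx P j *m H = - (H *m lay_bdmx P' j.+1).
  by rewrite /lay_bdmx -mulmxA DH mulmxN !mulmxA lH.
have rE j : bd_rank P j = bd_rank P' j.+1.
  apply/eqP; rewrite eqn_leq; apply/andP; split.
    have E1 : lay_bdmx P j = lay_bdmx P j *m H *m (bdmx *m prmx P).
      by rewrite /lay_bdmx -(fbdmx_prmx P) -[in LHS]pHBp !mulmxA.
    rewrite {1}/bd_rank E1 (leq_trans (mxrankM_maxl _ _)) // bH mxrank_opp.
    exact: mxrankM_maxr.
  have E2 : lay_bdmx P' j.+1 = - (prmx P' *m bdmx *m (lay_bdmx P j *m H)).
    by rewrite bH mulmxN opprK /lay_bdmx -(P'l j.+1) -{1}p'BHp' !mulmxA.
  rewrite {1}/bd_rank E2 mxrank_opp (leq_trans (mxrankM_maxr _ _)) //.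
  exact: mxrankM_maxl.
have cE : lay_card P i = lay_card P' i.+1.
  rewrite /lay_card -!rank_prmx; apply/eqP; rewrite eqn_leq; apply/andP; split.
    have -> : prmx (lay P i) = prmx (lay P i) *m H *m (bdmx *m prmx P).
      rewrite -[LHS](@prmxMr _ P) => [|S /andP[]//].
      by rewrite -{1}pHBp !mulmxA prmxMr // => S /andP[].
    rewrite (leq_trans (mxrankM_maxl _ _)) // lH; exact: mxrankM_maxr.
  have -> : prmx (lay P' i.+1) = prmx P' *m bdmx *m (prmx (lay P i) *m H).
    by rewrite lH -(P'l i.+1) -{1}p'BHp' !mulmxA.
  rewrite (leq_trans (mxrankM_maxr _ _)) //; exact: mxrankM_maxl.
by rewrite /hdim cE !rE.
Qed.
End Shift.

Lemma eq_hdim P Q : P =1 Q -> forall i, hdim P i = hdim Q i.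
Proof.
move=> PQ i; have lPQ k : lay P k =1 lay Q k by move=> S; rewrite /lay /= PQ.
have bPQ k : bd_rank P k = bd_rank Q k by rewrite /bd_rank /lay_bdmx (eq_prmx (lPQ k))
  !fbdmxE (eq_prmx PQ).
rewrite /hdim !bPQ /lay_card; congr (_ - _ - _)%N; apply: eq_card => S.
by rewrite !inE lPQ.
Qed.

Lemma hdim_le_card P i : (hdim P i <= lay_card P i)%N.
Proof. by rewrite /hdim -subnDA leq_subr. Qed.

Lemma hdim_shift0 v P : (forall S, P S -> v \in S) -> hdim P 0 = 0%N.
Proof.
move=> Pv; apply/eqP; rewrite -leqn0 (leq_trans (hdim_le_card _ _)) // leqn0 cards_eq0.
apply/eqP/setP=> S; rewrite !inE; apply/negP=> /andP[/Pv vS /eqP/cards0_eq S0].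
by rewrite S0 inE in vS.
Qed.

Lemma hdim_shift X P i : (forall S, P S -> [disjoint S & X]) ->
  hdim [pred S : {set 'I_n} | (X \subset S) && P (S :\: X)] i =
    if (i < #|X|)%N then 0%N else hdim P (i - #|X|)%N.
Proof.
have [k] := ubnP #|X|; elim: k X i => // k IHk X i.
have [->|[v vX]] := set_0Vmem X.
  by rewrite cards0 subn0 => _ _; apply: eq_hdim => S; rewrite /= sub0set setD0.
rewrite ltnS => leXk PX; pose Y := X :\ v.
have cX : #|X| = #|Y|.+1 by rewrite (cardsD1 v) vX.
have vY : v \notin Y by rewrite !inE eqxx.
have PY S : P S -> [disjoint S & Y].
  by move/PX => dSX; apply: disjointWr dSX; rewrite subsetDl.
pose PS := [pred S : {set 'I_n} | (Y \subset S) && P (S :\: Y)].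
have PSv S : PS S -> v \notin S.
  case/andP=> _ /PX; rewrite -setI_eq0 => /eqP/setP/(_ v).
  by rewrite !inE vX eqxx andbT /= => ->.
rewrite (@eq_hdim _ [pred S : {set 'I_n} | (v \in S) && PS (S :\ v)]) => [|S /=].
  rewrite cX; case: i => [|i]; first by rewrite (hdim_shift0 (v := v)) // => S /andP[].
  by rewrite (hdim_shift1 PSv) IHk // -?cX // ltnS subSS.
rewrite -{1}(setD1K vX) subUset sub1set -/Y; case: (boolP (v \in S)) => //= vS.
congr (_ && P _); last by rewrite setDDl setD1K.
apply/idP/idP => [YS|]; last by move/subset_trans; apply; rewrite subsetDl.
by rewrite subsetD YS disjoint_sym disjoints1.
Qed.

Lemma hdim_size P i : (n < i)%N -> hdim P i = 0%N.
Proof.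
move=> ni; apply/eqP; rewrite -leqn0 (leq_trans (hdim_le_card _ _)) // leqn0 cards_eq0.
apply/eqP/setP=> S; rewrite !inE; apply/negP=> /andP[_ /eqP Si].
by have := max_card S; rewrite card_ord Si leqNgt ni.
Qed.

End FamilyHomology.

(* The Euler characteristic does not depend on the field. *)
Lemma hdim_euler n (K L : fieldType) (P : pred {set 'I_n}) i : convex P ->
  (forall k, k != i -> hdim K P k = hdim L P k) -> hdim K P i = hdim L P i.
Proof.
move=> cP KL; have leK := bd_rank_le K _ cP; have leL := bd_rank_le L _ cP.
(* The alternating sum in disguise: the boundary ranks are determined from degree 0 upwards as far
   as i, and in [hi] from the empty layer n + 2 downwards as far as i + 1. These are the two ranks
   that enter degree i. *)
have lo k : (k <= i)%N -> bd_rank K P k = bd_rank L P k.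
  elim: k => [|k IH] ki; first by rewrite /bd_rank !lay_bdmx0 !mxrank0.
  have := KL k (negbT (ltn_eqF ki)); have := leK k; have := leL k.
  by rewrite /hdim (IH (ltnW ki)); lia.
have hi d k : (k + d = n.+2)%N -> (i < k)%N -> bd_rank K P k = bd_rank L P k.
  elim: d k => [|d IH] k kd ik.
    have c0 : lay_card P k = 0%N.
      apply/eqP; rewrite cards_eq0; apply/eqP/setP=> S; rewrite !inE.
      apply/negP=> /andP[_ /eqP Sk].
      by have := max_card S; rewrite card_ord Sk; lia.
    by have := leK k; have := leL k; rewrite c0; lia.
  have := KL k (negbT (gtn_eqF ik)); have := leK k; have := leL k.
  have := IH k.+1; rewrite /hdim => -> //; lia.
have [ni|ni] := leqP i n; last by rewrite !hdim_size.
rewrite /hdim lo // (hi (n.+1 - i)%N) //; lia.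
Qed.

Local Open Scope nat_scope.

(** * Cohomology of independence complexes *)

Lemma convexD n (P U : pred {set 'I_n}) : convex P ->
  (forall S T : {set 'I_n}, S \subset T -> U S -> P T -> U T) -> convex
    [pred S | P S && ~~ U S].
Proof.
move=> cP Uup S T X ST TX /andP[PS US] /andP[PX UX]; apply/andP; split.
  exact: cP PS PX.
by apply: contra UX => UT; apply: Uup UT PX.
Qed.

Lemma hdim_acyclic_up (K : fieldType) n (P U : pred {set 'I_n}) i : convex P ->
    {subset U <= P} -> (forall S T : {set 'I_n}, S \subset T -> U S -> P T -> U T) ->
    (forall j, hdim K U j = 0) ->
  hdim K P i = hdim K [pred S | P S && ~~ U S] i.
Proof.
move=> cP UP Uup U0; have [rho rhoE] := hdim_split K cP UP Uup.
have [+ r0 _] := rhoE i; have [_ r1 _] := rhoE i.+1.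
by move: r0 r1; rewrite !U0 !leqn0 => /eqP-> /eqP->; rewrite !addn0.
Qed.

Section Graph.
Variables (n : nat) (e : rel 'I_n).
Hypotheses (e_sym : symmetric e) (e_irr : irreflexive e).
Implicit Types (u v w : 'I_n) (S T W F : {set 'I_n}).

Definition indep F := [forall u in F, forall v in F, ~~ e u v].

Lemma indepP F : reflect {in F &, forall u v, ~~ e u v} (indep F).
Proof.
apply: (iffP forall_inP) => [h u v uF vF|h u uF]; last by apply/forall_inP=> v;
  apply: h.
by move/forall_inP: (h u uF); apply.
Qed.

Lemma indepS F F' : F \subset F' -> indep F' -> indep F.
Proof.
by move=> /subsetP FF' /indepP h; apply/indepP=> u v /FF' uF /FF' vF; apply: h.
Qed.

(* S encodes the face W :\: S of the independence complex of the subgraph induced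
   on W, so removing points from S is the coboundary of that complex and hbetti W i
   below is the dimension of its reduced cohomology in degree #|W| - i - 1. *)
Definition coface W : pred {set 'I_n} :=
  [pred S : {set 'I_n} | (S \subset W) && indep (W :\: S)].
Definition nbhd W v := [set u in W | e v u].
Definition degree_in W v := #|nbhd W v|.
Definition non_nbhd W v := [set u in W | (u != v) && ~~ e v u].

Lemma cofaceE W S : coface W S = (S \subset W) && indep (W :\: S). Proof. by []. Qed.

Lemma coface_convex W : convex (coface W).
Proof.
move=> S T X ST TX /andP[_ iS] /andP[XW _]; apply/andP; split.
  exact: subset_trans XW.
by apply: indepS iS; apply: setDS.
Qed.

Lemma coface_up W S T : S \subset T -> coface W S -> T \subset W -> coface W T.
Proof.
by move=> ST /andP[_ iS] TW; apply/andP; split=> //; apply: indepS iS; apply: setDS.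
Qed.

Lemma card_setD1 W v : v \in W -> #|W :\ v| = #|W|.-1.
Proof. by move=> vW; rewrite (cardsD1 v W) vW. Qed.

Lemma card_non_nbhd W v : v \in W -> #|W| = (#|non_nbhd W v| + degree_in W v).+1.
Proof.
move=> vW; rewrite (cardsD1 v W) vW add1n -(cardsID (nbhd W v) (W :\ v)) addnC.
congr (_ + _).+1; apply: eq_card => u; rewrite !inE; have [->|uv] := eqVneq u v;
  rewrite ?e_irr ?andbF //=; case: (u \in W); rewrite ?andbF ?andbT //.
Qed.

Section Betti.
Variable K : fieldType.
Definition hbetti W i := hdim K (coface W) i.
(** The guard stands for vanishing in negative degrees, where truncated subtraction would return
    degree 0. *)
Definition hbetti_shift k W i := if i < k then 0 else hbetti W (i - k).

Lemma hbetti_gt W i : #|W| < i -> hbetti W i = 0.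
Proof.
move=> Wi; apply/eqP; rewrite -leqn0 (leq_trans (hdim_le_card _ _ _)) // leqn0
  cards_eq0.
apply/eqP/setP=> S; rewrite !inE;
  apply/negP=> /andP[/andP[/subset_leq_card SW _]] /eqP Si.
by rewrite Si leqNgt Wi in SW.
Qed.

(** An isolated vertex may be added to or removed from any face, so it is the apex of a cone. *)
Lemma hbetti_isolated W v i : v \in W -> nbhd W v = set0 -> hbetti W i = 0.
Proof.
move=> vW N0; apply: (@hdim_toggle _ _ _ v) => [|S]; first exact: coface_convex.
have Nv u : u \in W -> e v u = false.
  by move=> uW; move/setP/(_ u): N0; rewrite !inE uW.
rewrite !cofaceE subUset sub1set vW /= subDset (setUidPr _ : [set v] :|: W = W)
  ?sub1set //.
congr (_ && _); apply/idP/idP; last first.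
  apply: indepS; apply: setDS; apply/subsetP=> x; rewrite !inE.
  by case/andP=> _ ->; rewrite orbT.
move=> /indepP h; apply/indepP=> x y; rewrite !inE => /andP[xS xW] /andP[yS yW].
have [->|xv] := eqVneq x v; first by rewrite Nv.
have [->|yv] := eqVneq y v; first by rewrite e_sym Nv.
by rewrite xv /= in xS; rewrite yv /= in yS; apply: h;
  rewrite !inE negb_or ?xv ?yv ?xS ?yS.
Qed.

(** In terms of the faces [W :\: S], [Uf] holds those that avoid v (the deletion) and [Lf] those
    that contain v (the link). A coface in [Lf] contains all neighbours of v, whence the shift by
    the degree in [hh_Lf]. *)
Let Uf W v : pred {set 'I_n} := [pred S : {set 'I_n} | coface W S && (v \in S)].
Let Lf W v : pred {set 'I_n} := [pred S : {set 'I_n} | coface W S && (v \notin S)].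

Lemma hh_Uf W v i : v \in W -> hdim K (Uf W v) i = hbetti_shift 1 (W :\ v) i.
Proof.
move=> vW; rewrite (@eq_hdim _ _ _
  [pred S : {set 'I_n} | (v \in S) && coface (W :\ v) (S :\ v)]).
  case: i => [|i]; first by rewrite (@hdim_shift0 _ _ v) // => S /andP[].
  rewrite (@hdim_shift1 _ _ v (coface (W :\ v))) /hbetti_shift ?subn1 // => S
    /andP[/subsetP SW _].
  by apply/negP=> /SW; rewrite !inE eqxx.
move=> S; rewrite /Uf /= -/(coface W S) !cofaceE andbC;
  case: (boolP (v \in S)) => //= vS.
congr (_ && indep _); first by rewrite subDset setD1K.
by apply/setP=> x; rewrite !inE; case: eqVneq => // ->; rewrite vS.
Qed.

Lemma hh_Lf W v i : v \in W -> hdim K (Lf W v) i = hbetti_shift (degree_in W v)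
  (non_nbhd W v) i.
Proof.
move=> vW; rewrite /hbetti_shift /degree_in -hdim_shift; last first.
  move=> S /andP[/subsetP SW _]; rewrite -setI_eq0; apply/eqP/setP=> x; rewrite !inE.
  by apply/negP=> /and3P[/SW]; rewrite !inE => /and3P[_ _ /negP].
apply: eq_hdim => S; rewrite /Lf /= -/(coface W S) !cofaceE; apply/idP/idP.
  case/andP=> /andP[/subsetP SW /indepP iS] vS.
  have NS x : x \in W -> e v x -> x \in S.
    move=> xW vx; apply: contraLR vx => xS; apply: iS; rewrite inE ?vS ?xS //.
  apply/and3P; split.
  - by apply/subsetP=> x; rewrite inE => /andP[]; apply: NS.
  - apply/subsetP=> x; rewrite !inE => /andP[xN xS]; have xW := SW x xS;
    rewrite xW /= in xN *.
    by rewrite xN andbT; apply: contraNneq vS => <-.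
  apply/indepP=> x y; rewrite !inE.
  move=> /andP[hx /and3P[xW _ /negPf vx]] /andP[hy /and3P[yW _ /negPf vy]].
  apply: iS; rewrite inE ?xW ?yW andbT; first by move: hx; rewrite xW vx.
  by move: hy; rewrite yW vy.
case/and3P=> /subsetP NS /subsetP SD /indepP iS.
have SW x : x \in S -> x \in W /\ x != v.
  move=> xS; have [xN|xN] := boolP (x \in nbhd W v).
    move: xN; rewrite inE => /andP[-> vx]; split=> //.
    by apply: contraTneq vx => ->; rewrite e_irr.
  by have := SD x; rewrite inE xN xS => /(_ isT); rewrite inE => /and3P[].
have vS : v \notin S by apply/negP=> /SW[_]; rewrite eqxx.
apply/andP; split=> //; apply/andP; split; first by apply/subsetP=> x /SW[].
have Nv x : x \in W :\: S -> e v x = false.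
  rewrite inE => /andP[xS xW]; apply: contraNF xS => vx; apply: NS; rewrite inE xW.
  exact: vx.
apply/indepP=> x y xF yF.
have [->|xv] := eqVneq x v; first by rewrite Nv.
have [->|yv] := eqVneq y v; first by rewrite e_sym Nv.
have vx := Nv x xF; have vy := Nv y yF; move: xF yF.
by rewrite !inE => /andP[xS xW] /andP[yS yW]; apply: iS;
  rewrite !inE ?(negPf xS) ?(negPf yS) ?andbF ?xv ?yv ?xW ?yW ?vx ?vy.
Qed.

Lemma les W v : v \in W -> exists rho : nat -> nat, forall i,
  [/\ hbetti W i + rho i + rho i.+1 = hbetti_shift (degree_in W v) (non_nbhd W v) i +
    hbetti_shift 1 (W :\ v) i,
      rho i <= hbetti_shift 1 (W :\ v) i & rho i.+1 <= hbetti_shift (degree_in W v)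
        (non_nbhd W v) i].
Proof.
move=> vW; have [] := @hdim_split _ K (coface W) (Uf W v) (@coface_convex W).
- by move=> S /andP[].
- by move=> S T /subsetP ST /andP[_ vS] PT; rewrite /Uf /= PT ST.
have eL i : hdim K [pred S | coface W S && ~~ Uf W v S] i = hbetti_shift
  (degree_in W v) (non_nbhd W v) i.
  rewrite -(hh_Lf i vW); apply: eq_hdim => S.
  change (coface W S && ~~ (coface W S && (v \in S)) = coface W S && (v \notin S)).
  by case: (coface W S).
move=> rho rhoE; exists rho => i; have := rhoE i.
by rewrite eL (hh_Uf i vW).
Qed.

Lemma hbetti_vanish W v i : v \in W ->
  hbetti_shift 1 (W :\ v) i = 0 -> hbetti_shift (degree_in W v) (non_nbhd W v) i = 0 ->
    hbetti W i = 0.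
Proof. by move=> /les[rho /(_ i)[r _ _]] z1 z2; move: r; rewrite z1 z2; lia. Qed.

(* The connecting maps of the long exact sequence vanish when, in the relevant
   degrees, one of their two ends does. *)
Lemma hbetti_split W v i : v \in W ->
    hbetti (W :\ v) i * hbetti_shift (degree_in W v) (non_nbhd W v) i = 0 ->
    (forall j, i = j.+1 -> hbetti (W :\ v) j * hbetti_shift (degree_in W v)
      (non_nbhd W v) j = 0) ->
  hbetti W i = hbetti_shift 1 (W :\ v) i + hbetti_shift (degree_in W v) (non_nbhd W v)
    i.
Proof.
move=> /les[rho rhoE] z1 z2; have [r1 r2 r3] := rhoE i.
have [_ r4 _] := rhoE i.+1; rewrite /hbetti_shift /= subSS subn0 in r4.
have rS0 : rho i.+1 = 0 by move: z1 => /eqP; rewrite muln_eq0 => /orP[] /eqP z; lia.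
suff r0 : rho i = 0 by lia.
case: i {z1 rS0 r1 r3 r4} z2 r2 => [|j] z2 r2; first by move: r2;
  rewrite /hbetti_shift /=; lia.
have [_ _ r5] := rhoE j; rewrite /hbetti_shift /= subSS subn0 in r2.
by move: (z2 j erefl) => /eqP; rewrite muln_eq0 => /orP[] /eqP z; lia.
Qed.

(* Faces that avoid v and whose points other than u are not adjacent to v form a
   cone E with apex u.  Discarding it separates the faces that contain v from the
   remaining faces that avoid v. *)
Lemma hbetti_dominated W u v i : u \in W -> v \in W -> u != v ->
    nbhd W u \subset v |: nbhd W v ->
  hbetti W i = hbetti_shift 1 (W :\ v) i + hbetti_shift (degree_in W v) (non_nbhd W v)
    i.
Proof.
move=> uW vW uv /subsetP dom.
pose E : pred {set 'I_n} := [pred S : {set 'I_n} | Uf W v S &&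
  ((W :\: S) :\ u \subset non_nbhd W v)].
have EU S : E S = Uf W v S && ((W :\: S) :\ u \subset non_nbhd W v) by [].
have UfE S : Uf W v S = coface W S && (v \in S) by [].
have LfE S : Lf W v S = coface W S && (v \notin S) by [].
have Eup S T : S \subset T -> E S -> coface W T -> E T.
  move=> ST /andP[/andP[fS vS] sS] fT; rewrite EU UfE fT (subsetP ST) //=.
  by apply: subset_trans sS; apply/setSD/setDS.
have cU : convex (Uf W v).
  move=> S T X ST TX /andP[fS vS] /andP[fX _]; rewrite UfE (subsetP ST) // andbT.
  exact: coface_convex fS fX.
have cE : convex E.
  move=> S T X ST TX ES /andP[/andP[fX _] _]; apply: Eup (ES) _ => //.
  by apply: coface_convex ST TX _ fX; case/andP: ES => /andP[].
have E0 j : hdim K E j = 0.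
  apply: (@hdim_toggle _ _ _ u) => // S; rewrite !EU !UfE.
  have -> : (v \in u |: S) = (v \in S :\ u) by rewrite !inE eq_sym (negPf uv).
  have -> : (W :\: (u |: S)) :\ u = (W :\: (S :\ u)) :\ u.
    by apply/setP=> x; rewrite !inE; case: eqVneq.
  case: (boolP ((W :\: (S :\ u)) :\ u \subset non_nbhd W v)) => [/subsetP sD|];
    rewrite ?andbF // !andbT.
  have uWW : u |: W = W by apply/setUidPr; rewrite sub1set.
  congr (_ && _); rewrite !cofaceE subUset sub1set uW subDset uWW /=.
  congr (_ && _).
  (* A neighbour of u is v or a neighbour of v by [dom], and E admits neither in the face. *)
  have Nu x : x \in W :\: (S :\ u) -> e u x = false.
    move=> xF; apply/negP=> ux.
    have xu : x != u by apply: contraTneq ux => ->; rewrite e_irr.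
    have := sD x; rewrite in_setD1 xu xF => /(_ isT); rewrite inE => /and3P[xW xv vx].
    have := dom x; rewrite !inE xW ux (negPf xv) (negPf vx) => /(_ isT).
    by [].
  apply/idP/idP; last first.
    by apply: indepS; apply: setDS; rewrite subDset setUA setUid subsetUr.
  move=> /indepP h; apply/indepP=> x y xF yF.
  have [->|xu] := eqVneq x u; first by rewrite Nu.
  have [->|yu] := eqVneq y u; first by rewrite e_sym Nu.
  move: xF yF; rewrite !inE xu yu /= => /andP[xS xW] /andP[yS yW].
  by apply: h; rewrite !inE negb_or ?xu ?yu ?xS ?yS.
have EW : {subset E <= coface W} by move=> S /andP[/andP[]].
have EV : {subset E <= Uf W v} by move=> S /andP[].
have Eup' S T : S \subset T -> E S -> Uf W v T -> E T.
  by move=> ST ES /andP[fT _]; apply: Eup ES fT.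
rewrite -hh_Uf // -hh_Lf // [hdim _ (Uf W v) _](hdim_acyclic_up i cU EV Eup' E0).
rewrite {1}/hbetti (hdim_acyclic_up i (@coface_convex W) EW Eup E0).
pose P : pred {set 'I_n} := [pred S | coface W S && ~~ E S].
pose Q : pred {set 'I_n} := [pred S | Uf W v S && ~~ E S].
have cP : convex P by apply: convexD Eup; apply: coface_convex.
have PE S : P S = coface W S && ~~ E S by [].
have QE S : Q S = Uf W v S && ~~ E S by [].
have PQE S : P S && ~~ Q S = Lf W v S.
  rewrite PE QE EU UfE LfE; case: (coface W S) => //=.
  by case: (v \in S) => //=; case: (_ \subset _).
have QP : {subset Q <= P}.
  by move=> S; change (Q S -> P S); rewrite QE PE UfE => /andP[/andP[-> _] ->].
have Qup S T : S \subset T -> Q S -> P T -> Q T.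
  move=> ST; rewrite !QE PE !UfE => /andP[/andP[fS vS] ES] /andP[fT ET].
  by rewrite ET fT (subsetP ST).
(* If S is the coface of a face containing v and T adds v to it, the points left are not adjacent to
   v. Then T lies in E, which has been discarded; so the faces containing v are closed upwards
   too. *)
have Lup S T : S \subset T -> P S && ~~ Q S -> P T -> P T && ~~ Q T.
  move=> ST; rewrite !PQE PE !LfE => /andP[fS vS] /andP[fT ET]; rewrite fT /=.
  apply: contra ET => vT; rewrite EU UfE fT vT /=.
  apply/subsetP=> x; rewrite !inE => /and3P[xu xT xW]; rewrite xW /=.
  have -> /= : x != v by apply: contraNneq xT => ->.
  case/andP: fS => _ /indepP h; apply: h; rewrite inE ?vS ?vW // xW andbT.
  by apply: contra xT; apply/subsetP.
rewrite -/P -/Q (@hdim_sum _ K P Q cP QP Qup Lup) addnC.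
by congr (_ + _); apply: eq_hdim => S; rewrite -PQE.
Qed.

Lemma deg0_nbhd W v : degree_in W v = 0 -> nbhd W v = set0.
Proof. by move/eqP; rewrite cards_eq0 => /eqP. Qed.

(** For [i = #|W|] this is reduced cohomology in degree -1 of a nonempty complex. In the induction,
    a vertex of positive degree leaves [W :\ v] nonempty, and its link term lies beyond the size of
    [del]. *)
Lemma hbetti_top W i : W != set0 -> #|W| <= i -> hbetti W i = 0.
Proof.
have [k] := ubnP #|W|; elim: k W i => // k IHk W i; rewrite ltnS => Wk /set0Pn[v vW].
rewrite leq_eqVlt => /orP[/eqP|]; last exact: hbetti_gt.
move=> Wi; have [/deg0_nbhd d0|d_gt0] := posnP (degree_in W v);
  first exact: hbetti_isolated vW d0.
have cW := card_non_nbhd vW; have cv := card_setD1 vW.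
apply: (hbetti_vanish vW); rewrite /hbetti_shift; case: ifP => // _;
  last by apply: hbetti_gt; lia.
by apply: IHk; rewrite -?card_gt0; lia.
Qed.

(** The bound that the Taylor resolution gives for an ideal generated by quadrics. At v of degree d
    >= 1, one term loses 1 vertex while the index drops by 1, the other loses d + 1 <= 2d vertices
    while it drops by d. *)
Lemma hbetti_large W i : 2 * i < #|W| -> hbetti W i = 0.
Proof.
have [k] := ubnP i; elim: k W i => // k IHk W i; rewrite ltnS => ik Wi.
have /card_gt0P[v vW] : 0 < #|W| by lia.
have [/deg0_nbhd d0|d_gt0] := posnP (degree_in W v); first exact: hbetti_isolated vW d0.
have cW := card_non_nbhd vW; have cv := card_setD1 vW.
by apply: (hbetti_vanish vW); rewrite /hbetti_shift; case: ifP => // iv; apply: IHk;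
  lia.
Qed.

(** In the boundary case of [hbetti_large], a degree d >= 2 makes d + 1 < 2d strict, so the link
    term is beyond the bound as well. *)
Lemma hbetti_matching W i v : #|W| = 2 * i -> v \in W -> degree_in W v != 1 -> hbetti W
  i = 0.
Proof.
move=> Wi vW; have [/deg0_nbhd d0 _|d_gt0 d1] := posnP (degree_in W v);
  first exact: hbetti_isolated vW d0.
have cW := card_non_nbhd vW; have cv := card_setD1 vW.
apply: (hbetti_vanish vW); rewrite /hbetti_shift; case: ifP => // iv;
  apply: hbetti_large; lia.
Qed.

Lemma hbetti_shift0 k W i : (k <= i -> hbetti W (i - k) = 0) -> hbetti_shift k W i = 0.
Proof. by rewrite /hbetti_shift; case: ltnP => // _; apply. Qed.

(** The independence complex of W is the disjoint union of those of C and [W :\: C]. Reduced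
    cohomology in degree 0 is additive up to one extra dimension, and C contributes none. *)
Lemma hbetti_join (C W : {set 'I_n}) : C \subset W -> C != set0 -> W :\: C != set0 ->
    {in C & W :\: C, forall u v, e u v} -> hbetti C #|C|.-1 = 0 ->
  hbetti W #|W|.-1 = (hbetti (W :\: C) #|W :\: C|.-1).+1.
Proof.
move=> CW C0 C'0 full bC; set C' := W :\: C.
have cW : #|W| = #|C| + #|C'| by rewrite -(cardsID C W) (setIidPr CW).
have C'W : C' \subset W by rewrite subsetDl.
have C_gt0 : 0 < #|C| by rewrite card_gt0.
have C'_gt0 : 0 < #|C'| by rewrite card_gt0.
have WC' : W :\: C' = C.
  by apply/setP=> x; rewrite !inE; have := subsetP CW x; case: (x \in C);
    case: (x \in W) => //= ->.
(* [U1] holds the faces inside C, [P2] those inside C', and [U2] below only the empty face. As no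
   face meets both parts, what [U1] leaves is [P2] without [U2], which links the two exact
   sequences. *)
pose U1 : pred {set 'I_n} := [pred S : {set 'I_n} | (C' \subset S) && coface C
  (S :\: C')].
pose P2 : pred {set 'I_n} := [pred S : {set 'I_n} | (C \subset S) && coface C'
  (S :\: C)].
have part (A B S : {set 'I_n}) : A \subset W -> B = W :\: A ->
    (B \subset S) && coface A (S :\: B) = coface W S && (B \subset S).
  move=> /subsetP AW BE; rewrite andbC.
  case: (boolP (B \subset S)) => [/subsetP BS|]; rewrite ?andbF // !andbT.
  rewrite !cofaceE; congr (_ && indep _).
    rewrite subDset BE; have -> // : W :\: A :|: A = W.
    by apply/setP=> x; rewrite !inE; have := AW x; case: (x \in A) => //= [->|];
      rewrite ?orbF.
  apply/setP=> x; have := BS x; rewrite BE !inE; have := AW x.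
  by case: (x \in A); case: (x \in W); case: (x \in S) => //= h1 h2;
    first [by have := h1 isT | by have := h2 isT].
have U1E S : U1 S = coface W S && (C' \subset S) by apply: part.
have P2E S : P2 S = coface W S && (C \subset S) by apply: part; rewrite ?WC'.
have disj (A B S : {set 'I_n}) : A \subset W -> B = W :\: A -> coface A S ->
  [disjoint S & B].
  by move=> AW -> /andP[SA _]; apply: disjointWl SA _; rewrite disjoints_subset;
    apply/subsetP=> x xA; rewrite !inE xA.
have hU1 i : hdim K U1 i = hbetti_shift #|C'| C i.
  by apply: hdim_shift => S; apply: disj.
have hP2 i : hdim K P2 i = hbetti_shift #|C| C' i.
  by apply: hdim_shift => S; apply: disj; rewrite ?WC'.
pose U2 : pred {set 'I_n} := [pred S : {set 'I_n} | S == W].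
have hU2 i : hdim K U2 i = (i == #|W|).
  have cE j : lay_card U2 j = (j == #|W|).
    rewrite /lay_card; have [->|jW] := eqVneq j #|W|.
      rewrite -[RHS](cards1 W); apply: eq_card => S; rewrite !inE /lay /=.
      by rewrite /U2 /=; case: (eqVneq S W) => [->|_]; rewrite /= ?eqxx.
    apply/eqP; rewrite cards_eq0; apply/eqP/setP=> S; rewrite !inE /lay /=.
    by rewrite /U2 /=; case: (eqVneq S W) => [->|] //=; rewrite eq_sym (negPf jW).
  have cU2 : convex U2.
    by move=> S T X ST TX /eqP SW /eqP XW; rewrite /U2 /= eqEsubset -{1}XW TX -SW.
  have le j := bd_rank_le K j cU2.
  case: i => [|i].
    have r0 : bd_rank K U2 0 = 0 by rewrite /bd_rank lay_bdmx0 mxrank0.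
    by have := le 0; have := le 1; rewrite !cE /hdim cE r0; lia.
  have := le i; have := le i.+1; have := le i.+2; rewrite !cE /hdim cE; lia.
have [|S T|r1 r1E] := @hdim_split _ K (coface W) U1 (@coface_convex W).
- by move=> S; change (U1 S -> coface W S); rewrite U1E => /andP[].
- by move=> ST; rewrite !U1E => /andP[_ CS] ->; rewrite (subset_trans CS ST).
have cP2 : convex P2.
  move=> S T X ST TX; rewrite !P2E => /andP[fS CS] /andP[fX _].
  by rewrite (subset_trans CS ST) (coface_convex ST TX fS fX).
have [|S T|r2 r2E] := @hdim_split _ K P2 U2 cP2.
- move=> S /eqP->; change (is_true (P2 W)); rewrite P2E CW andbT cofaceE subxx setDv.
  by apply/indepP=> u v; rewrite inE.
- move=> ST /eqP SW; rewrite P2E cofaceE => /andP[/andP[TW _] _].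
  by rewrite /U2 /= eqEsubset TW -SW ST.
have LE S : P2 S && ~~ U2 S = coface W S && ~~ U1 S.
  rewrite U1E P2E; case: (boolP (coface W S)) => //= fS.
  have /andP[SW /indepP iS] := fS; apply/idP/idP.
    case/andP=> CS; apply: contra => C'S; rewrite /U2 /= eqEsubset SW.
    by rewrite -(setID W C) subUset C'S andbT (subset_trans (subsetIr _ _)).
  case/subsetPn=> y yC' yS; rewrite /U2 /=.
  have yW : y \in W by rewrite (subsetP C'W).
  apply/andP; split; last by apply: contraNneq yS => ->.
  apply/subsetP=> x xC; apply: contraTT (full x y xC yC') => xS.
  by apply: iS; rewrite inE ?xS ?yS ?(subsetP CW x xC).
have hL i : hdim K [pred S | P2 S && ~~ U2 S] i = hdim K
  [pred S | coface W S && ~~ U1 S] i.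
  exact: eq_hdim.
have dE : #|W|.-1.+1 = #|W| by lia.
have [a1 _ _] := r1E #|W|.-1; have [_ a2 _] := r1E #|W|.-1; have [_ a3 _] := r1E #|W|.
have [a4 _ _] := r2E #|W|.-1; have [_ a5 _] := r2E #|W|.-1.
have [a6 _ a7] := r2E #|W|; have [_ a8 _] := r2E #|W|.+1.
rewrite ?(dE, hL, hU1, hP2, hU2) in a1 a2 a3 a4 a5 a6 a7 a8.
have z1 : hbetti_shift #|C'| C #|W|.-1 = 0.
  by apply: hbetti_shift0 => _; rewrite -[RHS]bC; congr hbetti; lia.
have z2 : hbetti_shift #|C'| C #|W| = 0 by apply: hbetti_shift0 => _;
  apply: hbetti_top; lia.
have z3 : hbetti_shift #|C| C' #|W| = 0 by apply: hbetti_shift0 => _;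
  apply: hbetti_top => //; lia.
have z4 : hbetti_shift #|C| C' #|W|.-1 = hbetti C' #|C'|.-1.
  by rewrite /hbetti_shift ifN; [congr hbetti|]; lia.
have z5 : hdim K [pred S | coface W S && ~~ U1 S] #|W| = 0.
  apply/eqP; rewrite -leqn0 (leq_trans (hdim_le_card _ _ _)) // leqn0 cards_eq0.
  apply/eqP/setP=> S; rewrite !inE; apply/negP=> /andP[/andP[fS]].
  rewrite U1E fS /= => CS /eqP cS; case/negP: CS.
  case/andP: fS => SW _; suff -> : S = W by [].
  by apply/eqP; rewrite eqEcard SW cS leqnn.
have e1 : (#|W|.-1 == #|W|) = false by apply/eqP; lia.
have e2 : (#|W|.+1 == #|W|) = false by apply/eqP; lia.
rewrite ?e1 ?e2 ?eqxx in a4 a5 a6 a8.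
rewrite -/(hbetti W _) in a1.
clear -z1 z2 z3 z4 z5 a1 a2 a3 a4 a5 a6 a7 a8; lia.
Qed.

End Betti.
End Graph.

(** * Independence of the field in degrees at most 5 *)

Ltac nlia := unfold reverse_coercion in *; simpl in *; lia.

Section Graph.
Variables (n : nat) (e : rel 'I_n).
Hypotheses (e_sym : symmetric e) (e_irr : irreflexive e).
Implicit Types (u v w : 'I_n) (S T W F : {set 'I_n}).

Local Notation b := (hbetti e).
Local Notation bs := (hbetti_shift e).
Local Notation nbr := (nbhd e).
Local Notation deg := (degree_in e).
Local Notation del := (non_nbhd e).

Lemma count_cross W v :
  \sum_(w in del W v) #|[set x in nbr W v | e w x]| =
  \sum_(x in nbr W v) #|[set w in del W v | e x w]|.
Proof.
have E (B : {set 'I_n}) w : #|[set x in B | e w x]| = \sum_(x in B) e w x.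
  rewrite -sum1_card big_mkcond [RHS]big_mkcond; apply: eq_bigr => x _.
  by rewrite inE; case: (x \in B).
rewrite (eq_bigr _ (fun w _ => E (nbr W v) w)).
rewrite [RHS](eq_bigr _ (fun w _ => E (del W v) w)).
by rewrite exchange_big; apply: eq_bigr => x _; apply: eq_bigr => y _; rewrite e_sym.
Qed.

Lemma deg_non_nbhd W v w : w \in del W v ->
  deg W w = deg (del W v) w + #|[set x in nbr W v | e w x]|.
Proof.
rewrite inE => /and3P[wW wv vw]; rewrite /deg -(cardsID (nbr W v) (nbr W w)) addnC.
congr (_ + _); apply: eq_card => x; rewrite !inE; have [->|xv] := eqVneq x v;
  rewrite ?[e w v]e_sym ?(negPf vw) ?e_irr ?andbF //=;
  by case: (x \in W); case: (e v x); case: (e w x).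
Qed.

Lemma cross_deg W v x : v \in W -> x \in nbr W v ->
  #|[set w in del W v | e x w]| < deg W x.
Proof.
move=> vW; rewrite inE => /andP[xW vx]; apply: proper_card; apply/properP; split.
  by apply/subsetP=> w; rewrite !inE => /andP[/andP[-> _] ->].
by exists v; rewrite !inE ?vW ?eqxx ?andbF //= e_sym.
Qed.

Lemma hbetti_euler (K L : fieldType) W i :
  (forall k, k != i -> b K W k = b L W k) -> b K W i = b L W i.
Proof. exact: hdim_euler (@coface_convex _ _ _). Qed.

(* This is the reduced cohomology in degree 0.  A maximal C for which it vanishes
   is completely joined to its complement, which is smaller. *)
Lemma hbetti_topm1_field (K L : fieldType) W : b K W #|W|.-1 = b L W #|W|.-1.
Proof.
have [k] := ubnP #|W|; elim: k W => // k IHk W; rewrite ltnS => Wk.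
have [->|[v vW]] := set_0Vmem W.
  by rewrite cards0; apply: hbetti_euler => j j0; rewrite !hbetti_gt ?cards0 // lt0n.
(* Vanishing is asked over both fields, so that one set C serves for K and for L; a single vertex
   provides a start. *)
pose P (C : {set 'I_n}) := [&& C \subset W, C != set0, b K C #|C|.-1 == 0 & b L C
  #|C|.-1 == 0].
have N1 : nbr [set v] v = set0.
  by apply/setP=> x; rewrite !inE; case: eqVneq => // ->; rewrite e_irr.
have /ex_maxset[C /maxsetP[/and4P[CW C0 /eqP bK /eqP bL] maxC]] : exists C, P C.
  exists [set v]; rewrite /P sub1set vW -card_gt0 cards1 /=.
  by rewrite !(hbetti_isolated e_sym _ _ (set11 v) N1) !eqxx.
(* If w is not adjacent to c, then w could be added to C: the deletion of w gives back C, and the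
   link of w contains c, so [hbetti_top] kills its term. *)
have full : {in C & W :\: C, forall u v, e u v}.
  move=> c w cC; rewrite inE => /andP[wC wW]; apply/idPn => cw.
  case/negP: (wC); rewrite -(maxC (w |: C)) ?subsetUr //; first by rewrite setU11.
  have wC' : w \in w |: C by rewrite setU11.
  have CE : (w |: C) :\ w = C by rewrite setU1K.
  have cD : c \in del (w |: C) w.
    by rewrite !inE cC orbT e_sym cw andbT /=; apply: contraNneq wC => <-.
  have cE := card_non_nbhd e_irr wC'; rewrite cardsU1 wC add1n in cE; case: cE => cE.
  have C_gt0 : 0 < #|C| by rewrite card_gt0.
  have z (M : fieldType) : b M C #|C|.-1 = 0 -> b M (w |: C) #|w |: C|.-1 = 0.
    move=> bM; apply: (hbetti_vanish e_sym e_irr wC'); rewrite ?CE cardsU1 wC add1n /=.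
      by apply: hbetti_shift0 => _; rewrite subn1.
    apply: hbetti_shift0 => _; apply: (hbetti_top e_sym e_irr);
      last by rewrite cE addnK.
    by apply/set0Pn; exists c.
  rewrite /P subUset sub1set wW CW (z K bK) (z L bL) !eqxx !andbT /=.
  by apply/set0Pn; exists w.
have [C'0|C'0] := eqVneq (W :\: C) set0.
  have -> : W = C by apply/eqP; rewrite eqEsubset CW -setD_eq0 C'0 eqxx.
  by rewrite bK bL.
rewrite !(hbetti_join e_sym e_irr CW C0 C'0 full) // IHk //.
have := cardsID C W; rewrite (setIidPr CW).
by move: C0; rewrite -card_gt0; nlia.
Qed.

Section Main.
Variables (K L : fieldType) (W : {set 'I_n}) (i : nat).
Hypotheses (i5 : i <= 5) (IH : forall j X, j < i -> b K X j = b L X j).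

Let bs_eq k X j : j <= i -> 0 < k -> bs K k X j = bs L k X j.
Proof. by move=> ji k0; rewrite /hbetti_shift; case: ltnP => // kj; apply: IH;
  nlia. Qed.

Let field_split v : v \in W -> 0 < deg W v ->
    (forall M, b M (W :\ v) i * bs M (deg W v) (del W v) i = 0) ->
    (forall M j, i = j.+1 -> b M (W :\ v) j * bs M (deg W v) (del W v) j = 0) ->
  b K W i = b L W i.
Proof.
move=> vW dv z1 z2; have sp M := hbetti_split e_sym e_irr vW (z1 M) (z2 M).
by rewrite !sp !bs_eq.
Qed.

Lemma hbetti_field_step : b K W i = b L W i.
Proof.
have [->|[x0 x0W]] := set_0Vmem W.
  case: i => [|k]; last by rewrite !hbetti_gt ?cards0.
  by have := hbetti_topm1_field K L set0; rewrite cards0.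
case: (pickP (fun v => (v \in W) && (deg W v == 0))) =>
  [v /andP[vW /eqP /deg0_nbhd d0]|iso].
  by rewrite !(hbetti_isolated e_sym _ _ vW d0).
have d_gt0 v : v \in W -> 0 < deg W v.
  by move=> vW; have := iso v; rewrite vW /= lt0n => ->.
case: (pickP (fun uv => [&& uv.1 \in W, uv.2 \in W, uv.1 != uv.2 &
                           nbr W uv.1 \subset uv.2 |: nbr W uv.2])).
  case=> u v /and4P[/= uW vW uv dom].
  by rewrite !(hbetti_dominated e_sym e_irr _ _ uW vW uv dom) !bs_eq // d_gt0.
move=> nd.
have {}nd u v : u \in W -> v \in W -> u != v -> ~~ (nbr W u \subset v |: nbr W v).
  by move=> uW vW uv; have := nd (u, v); rewrite /= uW vW uv /= => ->.
(* A vertex with a single neighbour w would be dominated by w. *)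
have d_ge2 v : v \in W -> 2 <= deg W v.
  move=> vW; rewrite ltn_neqAle d_gt0 // andbT eq_sym; apply/negP=> /cards1P[w Nv].
  have : w \in nbr W v by rewrite Nv set11.
  rewrite inE => /andP[wW vw]; have vw' : v != w by apply: contraTneq vw => ->;
    rewrite e_irr.
  by have := nd v w vW wW vw'; rewrite Nv sub1set setU11.
have W0 : W != set0 by apply/set0Pn; exists x0.
have [di|di] := leqP #|W| i; first by rewrite !(hbetti_top e_sym e_irr).
have [d1|d1] := eqVneq #|W| i.+1; first by have := hbetti_topm1_field K L W; rewrite d1.
have [d2|d2] := eqVneq #|W| i.+2.
  apply: hbetti_euler => k ki; case: (ltngtP k i) ki => // ki _; first exact: IH.
  have [->|ki'] := eqVneq k i.+1; first by have := hbetti_topm1_field K L W; rewrite d2.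
  by rewrite !(hbetti_top e_sym e_irr) //; nlia.
have d3 : i.+3 <= #|W| by nlia.
have [d4|d4] := ltnP (2 * i) #|W|; first by rewrite !(hbetti_large e_sym e_irr).
(* One of the two connecting maps at v vanishes for reasons of size. *)
have low M v j : v \in W -> i = j.+1 -> bs M (deg W v) (del W v) j = 0.
  move=> vW ij; apply: hbetti_shift0 => dj; apply: (hbetti_large e_sym e_irr).
  (* With d the degree, [del W v] has at least i + 2 - d vertices. This exceeds 2(i - 1 - d) because
     i < d + 4, by [i <= 5] and d >= 2. *)
  by have := card_non_nbhd e_irr vW; have := d_ge2 v vW; nlia.
have easy v : v \in W -> (forall M, bs M (deg W v) (del W v) i = 0) -> b K W i = b L W
  i.
  move=> vW z; apply: (field_split vW); first exact: d_gt0.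
    by move=> M; rewrite z muln0.
  by move=> M j ij; rewrite (low M v j) ?muln0.
(* The condition says that [del W v], with #|W| - d - 1 vertices, has more than 2(i - d) of them. *)
case: (pickP (fun v => (v \in W) && (2 * i + 1 < #|W| + deg W v))).
  move=> v /andP[vW big]; apply: (easy v vW) => M; apply: hbetti_shift0 => dj.
  by apply: (hbetti_large e_sym e_irr); have := card_non_nbhd e_irr vW; nlia.
move=> small; have {}small v : v \in W -> #|W| + deg W v <= 2 * i + 1.
  by move=> vW; have := small v; rewrite vW /=; nlia.
(* Now [del W v] has exactly 2(i - d) vertices, so the link term vanishes unless all degrees in it
   are 1. *)
case: (pickP (fun vw => [&& vw.1 \in W, #|W| + deg W vw.1 == 2 * i + 1,
      vw.2 \in del W vw.1 & deg (del W vw.1) vw.2 != 1])).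
  case=> v w /and4P[/= vW /eqP eqv wD dw]; apply: (easy v vW) => M;
    apply: hbetti_shift0 => dj.
  apply: (hbetti_matching e_sym e_irr _ _ wD dw); have := card_non_nbhd e_irr vW; nlia.
move=> mat.
have {}mat v w : v \in W -> #|W| + deg W v = 2 * i + 1 -> w \in del W v -> deg
  (del W v) w = 1.
  move=> vW eqv wD; have := mat (v, w); rewrite /= vW eqv wD eqxx /=.
  by move/negbFE/eqP.
(* Edges between [del W v] and [nbr W v] are counted twice: w has one neighbour inside [del W v] and
   all others in [nbr W v], while x spends at least one of its edges on v. *)
have cross v : v \in W -> #|W| + deg W v = 2 * i + 1 ->
    \sum_(w in del W v) (deg W w).-1 <= \sum_(x in nbr W v) (deg W x).-1.
  move=> vW eqv; apply: (@leq_trans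
    (\sum_(w in del W v) #|[set x in nbr W v | e w x]|)).
    by apply: leq_sum => w wD; rewrite (deg_non_nbhd wD) (mat v) //; nlia.
  rewrite count_cross; apply: leq_sum => x xN.
  by have := cross_deg vW xN; nlia.
(* Here all degrees are 2, so [cross] bounds [del W x0], which has 2i - 4 >= 4 vertices, by 2. *)
have [dW|dW] := eqVneq #|W| (2 * i).-1.
  have dx x : x \in W -> deg W x = 2.
    by move=> xW; have := d_ge2 x xW; have := small x xW; nlia.
  have eqx : #|W| + deg W x0 = 2 * i + 1 by rewrite dx //; nlia.
  have := cross x0 x0W eqx; rewrite (eq_bigr (fun=> 1)); last first.
    by move=> w; rewrite inE => /and3P[/dx->].
  rewrite [X in _ <= X](eq_bigr (fun=> 1)); last first.
    by move=> w; rewrite inE => /andP[/dx->].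
  rewrite !sum1_card -/(deg W x0); have := card_non_nbhd e_irr x0W; have := dx x0 x0W;
    nlia.
(* What is left is i + 3 <= #|W| <= 2i - 2. *)
have i_eq : i = 5 by have := small x0 x0W; have := d_ge2 x0 x0W; nlia.
have W8 : #|W| = 8 by have := small x0 x0W; have := d_ge2 x0 x0W; nlia.
have dx x : x \in W -> deg W x = 2 \/ deg W x = 3.
  by move=> xW; have := d_ge2 x xW; have := small x xW; nlia.
(* The remaining case: 8 vertices, all degrees 2 or 3, and deleting the closed
   neighbourhood of a vertex of degree 3 leaves two disjoint edges. *)
suff [p pW bp] : exists2 p, p \in W & forall M, b M (W :\ p) i = 0.
  apply: (field_split pW); first exact: d_gt0.
    by move=> M; rewrite bp.
  by move=> M j ij; rewrite (low M p j) ?muln0.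
have neq x y : e x y -> x != y by apply: contraTneq => ->; rewrite e_irr.
(* If p and q were adjacent, u would be dominated by p. *)
have tri u p q : u \in W -> nbr W u = [set p; q] -> e p q = false.
  move=> uW Nu; apply/negP=> pq.
  have : p \in nbr W u by rewrite Nu !inE eqxx.
  have : q \in nbr W u by rewrite Nu !inE eqxx orbT.
  rewrite !inE => /andP[qW uq] /andP[pW up].
  have /negP[] := nd u p uW pW (neq _ _ up).
  apply/subsetP=> x; rewrite Nu !inE => /orP[->//|/eqP->].
  by rewrite qW pq orbT.
have pair u q : u \in W -> deg W u = 2 -> q \in nbr W u -> exists p, nbr W u =
  [set p; q].
  move=> uW /eqP/cards2P[y [z [yz Nu]]]; rewrite Nu !inE => /orP[]/eqP->.
    by exists z; rewrite setUC.
  by exists y.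
have adj x y : y \in nbr W x -> y \in W /\ e x y by rewrite inE => /andP.
(* In [W :\ p] the vertex u has q as its only neighbour. Removing q isolates u and kills the
   deletion term at q, so only the link term [z] needs an argument. *)
have [p [q [u [uW Nu pW qW z]]]] : exists p q u,
  [/\ u \in W, nbr W u = [set p; q], p \in W, q \in W &
    forall M, bs M (deg (W :\ p) q) (del (W :\ p) q) i = 0]; last first.
  exists p => // M.
  have up : e u p by have := adj u p; rewrite Nu !inE eqxx => /(_ isT)[].
  have uq : e u q by have := adj u q; rewrite Nu !inE eqxx orbT => /(_ isT)[].
  have pq := tri u p q uW Nu.
  have qWp : q \in W :\ p.
    by rewrite !inE qW andbT; apply: contraTneq (d_ge2 u uW) => qp;
      rewrite /degree_in Nu qp setUid cards1.
  apply: (hbetti_vanish e_sym e_irr qWp _ (z M)); apply: hbetti_shift0 => _.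
  apply: (hbetti_isolated e_sym _ (v := u)).
    by rewrite !inE uW (neq _ _ uq) (neq _ _ up).
  apply/setP=> x; rewrite !inE; apply/negP=> /andP[/and3P[xq xp xW] ux].
  have : x \in nbr W u by rewrite inE xW.
  by rewrite Nu !inE (negPf xq) (negPf xp).
have nbr_sub (X Y : {set 'I_n}) x : X \subset Y -> nbr X x \subset nbr Y x.
  by move=> /subsetP XY; apply/subsetP=> y; rewrite !inE => /andP[/XY-> ->].
(* If q has degree 3, [del W q] is a perfect matching that contains p; once p is removed, its
   partner p' is isolated. *)
case: (pickP (fun qu => [&& qu.1 \in W, deg W qu.1 == 3, qu.2 \in nbr W qu.1 & deg W
  qu.2 == 2])).
  case=> q u /and4P[/= qW /eqP dq uN /eqP du].
  have [uW qu] := adj _ _ uN.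
  have [p Nu] : exists p, nbr W u = [set p; q].
    by apply: pair; rewrite // inE qW e_sym.
  have pq := tri u p q uW Nu.
  have [pW up] : p \in W /\ e u p by apply: adj; rewrite Nu !inE eqxx.
  have pnq : p != q.
    by apply: contra_eq_neq du => eqpq; rewrite /degree_in Nu eqpq setUid cards1.
  exists p, q, u; split=> // M; apply: hbetti_shift0 => _.
  have mq w : w \in del W q -> deg (del W q) w = 1 by apply: mat => //;
    rewrite W8 dq i_eq.
  have pD : p \in del W q by rewrite inE pW pnq e_sym pq.
  have /eqP/cards1P[p' Np] := mq p pD.
  have : p' \in nbr (del W q) p by rewrite Np set11.
  rewrite inE => /andP[p'D pp'].
  have DE : del (W :\ p) q = del W q :\ p by apply/setP=> x; rewrite !inE -!andbA.
  apply: (hbetti_isolated e_sym _ (v := p')).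
    by rewrite DE !inE eq_sym (neq _ _ pp'); move: p'D; rewrite inE.
  have /eqP/cards1P[y Ny] := mq p' p'D.
  have : p \in nbr (del W q) p' by rewrite inE pD e_sym.
  rewrite Ny => /set1P py; apply/setP=> x; rewrite DE [in RHS]inE; apply/negP.
  rewrite inE => /andP[/setD1P[xp xD] px].
  have : x \in nbr (del W q) p' by rewrite inE xD.
  by rewrite Ny -py inE (negPf xp).
move=> no3.
have nb3 q u : q \in W -> deg W q = 3 -> u \in nbr W q -> deg W u = 3.
  move=> qW dq uN; have [uW _] := adj _ _ uN.
  by have := no3 (q, u); rewrite /= qW dq uN /=; case: (dx u uW) => ->.
(* Degree 3 spreads from x to its neighbours by [nb3], and on to [del W x], where each vertex has
   degree 1 and so needs a neighbour in [nbr W x]. Then [cross] reads 2 * 4 <= 2 * 3. *)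
have all2 x : x \in W -> deg W x = 2.
  move=> xW; case: (dx x xW) => // d3x.
  have eqx : #|W| + deg W x = 2 * i + 1 by rewrite W8 d3x i_eq.
  have := cross x xW eqx; rewrite (eq_bigr (fun=> 2)); last first.
    move=> w wD; have wW : w \in W by move: wD; rewrite inE => /andP[].
    have := d_ge2 w wW; rewrite (deg_non_nbhd wD) (mat x) // => c1.
    have /card_gt0P[y] : 0 < #|[set x0 in nbr W x | e w x0]| by nlia.
    rewrite inE => /andP[yN wy]; have [yW xy] := adj _ _ yN.
    have dy := nb3 x y xW d3x yN.
    have := nb3 y w yW dy; rewrite inE wW e_sym wy (deg_non_nbhd wD) (mat x) //.
    by move=> /(_ isT) ->.
  rewrite [X in _ <= X](eq_bigr (fun=> 2)); last by move=> y yN; rewrite (nb3 x).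
  rewrite !sum_nat_const; have := card_non_nbhd e_irr xW; move: d3x;
    rewrite /degree_in => ->; nlia.
pose u := x0; have uW : u \in W := x0W.
have /eqP/cards2P[p [q [pnq Nu]]] := all2 u uW.
have pq := tri u p q uW Nu.
have [pW up] : p \in W /\ e u p by apply: adj; rewrite Nu !inE eqxx.
have [qW uq] : q \in W /\ e u q by apply: adj; rewrite Nu !inE eqxx orbT.
exists p, q, u; split=> // M; apply: hbetti_shift0 => _.
have qWp : q \in W :\ p by rewrite !inE qW eq_sym pnq.
have dq : deg (W :\ p) q = 2.
  rewrite -(all2 q qW); apply: eq_card => x; rewrite !inE.
  by have [->|] := eqVneq x p; rewrite //= e_sym pq andbF.
(* The remaining term is b_3 of X, which has 7 - 1 - 2 = 4 vertices. The second neighbour s of p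
   will be found in X; having lost p, it has degree at most 1 there. *)
rewrite dq i_eq; set X := del _ _.
have cX : #|X| = 4.
  by have := card_non_nbhd e_irr qWp; rewrite card_setD1 // dq W8 addn2 => -[<-].
have [s Np] : exists s, nbr W p = [set s; u].
  by apply: pair; rewrite ?all2 // inE uW e_sym.
have [sW ps] : s \in W /\ e p s by apply: adj; rewrite Np !inE eqxx.
have su : s != u.
  by apply: contraTneq (d_ge2 p pW) => su; rewrite /degree_in Np su setUid cards1.
have qs : e q s = false.
  apply/negP=> qs; have Nq : nbr W q = [set s; u].
    apply/eqP; rewrite eq_sym eqEcard; apply/andP; split.
      by apply/subsetP=> x; rewrite !inE => /orP[]/eqP->; rewrite ?sW ?uW // e_sym.
    by rewrite -/(deg W q) all2 // cards2 su.
  by have := nd q p qW pW; rewrite eq_sym pnq Nq Np subsetUr => /(_ isT).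
have sX : s \in X.
  rewrite !inE eq_sym (neq _ _ ps) sW qs /= andbT.
  by apply: contraTneq ps => ->; rewrite pq.
have dsX : deg X s <= 1.
  rewrite -ltnS -(all2 s sW); apply: proper_card; apply/properP; split.
    by apply: nbr_sub; apply/subsetP=> x; rewrite !inE => /andP[/andP[_ ->]].
  by exists p; rewrite !inE ?pW ?eqxx //= e_sym.
have [/deg0_nbhd d0|] := posnP (deg X s);
  first exact: (hbetti_isolated e_sym _ _ sX d0).
move=> ds; have /cards1P[m Nm] : deg X s == 1 by rewrite eqn_leq dsX.
have : m \in nbr X s by rewrite Nm set11.
rewrite inE => /andP[mX sm].
have mW : m \in W by move: mX; rewrite !inE => /andP[/andP[_ ->]].
have XW : X \subset W by apply/subsetP=> x; rewrite !inE => /andP[/andP[_ ->]].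
have cm := card_non_nbhd e_irr mX.
have dm : deg X m <= 2 by rewrite -(all2 m mW); apply/subset_leq_card/nbr_sub.
(* Removing m isolates s. The link term lives on [del X m], which has 3 - [deg X m] >= 1 vertices
   and is taken in exactly that degree, so [hbetti_top] applies. *)
apply: (hbetti_vanish e_sym e_irr mX); apply: hbetti_shift0 => _.
  apply: (hbetti_isolated e_sym _ (v := s)); first by rewrite !inE (neq _ _ sm) /=;
    move: sX; rewrite !inE.
  apply/setP=> x; rewrite [in RHS]inE; apply/negP;
    rewrite inE => /andP[/setD1P[xm xX] sx].
  have : x \in nbr X s by rewrite inE xX.
  by rewrite Nm inE (negPf xm).
have c3 : #|del X m| + deg X m = 3 by move: cm; rewrite cX => -[].
apply: (hbetti_top e_sym e_irr);
  last by rewrite leq_eqVlt -(eqn_add2r (deg X m)) c3 subnK ?eqxx // (leq_trans dm).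
by rewrite -card_gt0 -(ltn_add2r (deg X m)) c3 add0n ltnS.
Qed.
End Main.

Lemma hbetti_field (K L : fieldType) i W : i <= 5 -> b K W i = b L W i.
Proof.
elim/ltn_ind: i W => i IH W i5; apply: hbetti_field_step => // j X ji.
by apply: IH => //; nlia.
Qed.
End Graph.

Local Open Scope ring_scope.

(** * The Koszul complex of a polynomial ring *)

Section Monomials.
Variables (n : nat) (K : fieldType).
Local Notation R := {mpoly K[n]}.
Implicit Types (p q : R) (m k : 'X_{1..n}) (s v : 'I_n) (S T : {set 'I_n}).

Lemma mnmU_le s m : (U_(s) <= m)%MM = (0 < m s)%N.
Proof.
apply/mnm_lepP/idP => [/(_ s)|ms t]; first by rewrite mnm1E eqxx.
by rewrite mnm1E; case: eqVneq => [<-|_] //=.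
Qed.

Lemma mcoeffXUM s p m : ('X_s * p)@_m = if (0 < m s)%N then p@_(m - U_(s)) else 0.
Proof.
rewrite mulrC -mnmU_le; case: ifPn => [le|nle].
  by rewrite -{1}(submK le) addmC mcoeffMX.
apply: memN_msupp_eq0; rewrite (perm_mem (msuppMX _ _)).
apply: contra nle => /mapP[k _ ->]; apply/mnm_lepP=> i.
by rewrite mnmDE leq_addr.
Qed.

Definition mfilt (Q : pred 'X_{1..n}) p : R := \sum_(m <- msupp p | Q m) p@_m *: 'X_[m].

Lemma mcoeff_mfilt Q p m : (mfilt Q p)@_m = if Q m then p@_m else 0.
Proof.
rewrite raddf_sum big_mkcond /=.
have [mp|mp] := boolP (m \in msupp p); last first.
  rewrite (memN_msupp_eq0 mp) if_same big_seq big1 // => k kp.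
  case: ifP => // _; rewrite mcoeffZ mcoeffX.
  by case: eqVneq kp mp => [->->|_ _ _]; rewrite ?mulr0.
rewrite (bigD1_seq m) ?msupp_uniq //= big1 ?addr0 => [|k /negPf km].
  by rewrite mcoeffZ mcoeffX eqxx mulr1.
by rewrite mcoeffZ mcoeffX km mulr0 if_same.
Qed.

Lemma mfilt_is_additive Q : zmod_morphism (mfilt Q).
Proof.
move=> p q; apply/mpolyP=> m; rewrite mcoeffB !mcoeff_mfilt mcoeffB.
by case: ifP; rewrite ?subr0.
Qed.
HB.instance Definition _ Q := GRing.isZmodMorphism.Build R R (mfilt Q)
  (mfilt_is_additive Q).

(** Monomials free of X_v are dropped, which makes this an additive left inverse of multiplication
    by X_v. *)
Definition mdivX v p : R := \sum_(m <- msupp p | (0 < m v)%N) p@_m *: 'X_[m - U_(v)].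

Lemma mcoeff_mdivX v p m : (mdivX v p)@_m = p@_(m + U_(v)).
Proof.
rewrite raddf_sum big_mkcond /=.
have E k : (0 < k v)%N -> ((k - U_(v))%MM == m) = (k == (m + U_(v))%MM).
  rewrite -mnmU_le => kv; apply/eqP/eqP => [<-|->]; first by rewrite submK.
  by rewrite addmK.
have [mp|mp] := boolP ((m + U_(v))%MM \in msupp p); last first.
  rewrite (memN_msupp_eq0 mp) big_seq big1 // => k kp.
  case: ifP => // kv; rewrite mcoeffZ mcoeffX E //.
  by case: eqVneq kp mp => [->->|_ _ _]; rewrite ?mulr0.
rewrite (bigD1_seq (m + U_(v))%MM) ?msupp_uniq //= big1 ?addr0 => [|k /negPf km].
  by rewrite mnmDE mnm1E eqxx addn1 mcoeffZ mcoeffX addmK eqxx mulr1.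
by case: ifP => // kv; rewrite mcoeffZ mcoeffX E // km mulr0.
Qed.

Lemma mdivX_is_additive v : zmod_morphism (mdivX v).
Proof. by move=> p q; apply/mpolyP=> m; rewrite mcoeffB !mcoeff_mdivX mcoeffB. Qed.
HB.instance Definition _ v := GRing.isZmodMorphism.Build R R (mdivX v)
  (mdivX_is_additive v).

Lemma mdivXK v p : mdivX v ('X_v * p) = p.
Proof.
apply/mpolyP=> m; rewrite mcoeff_mdivX mcoeffXUM mnmDE mnm1E eqxx addn1 /=.
by rewrite addmK.
Qed.

Lemma mdivXM v s p : s != v -> mdivX v ('X_s * p) = 'X_s * mdivX v p.
Proof.
move=> sv; apply/mpolyP=> m; rewrite mcoeff_mdivX !mcoeffXUM mnmDE mnm1E.
rewrite eq_sym (negPf sv) addn0; case: ifP => // ms; rewrite mcoeff_mdivX.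
congr (_@__); apply/mnmP=> i; rewrite !(mnmDE, mnmBE) !mnm1E.
by case: (eqVneq s i) => [<-|_]; rewrite ?subn0 // eq_sym (negPf sv) !addn0.
Qed.

Lemma mdivX_mul v p : (forall m, p@_m != 0 -> (0 < m v)%N) -> 'X_v * mdivX v p = p.
Proof.
move=> pv; apply/mpolyP=> m; rewrite mcoeffXUM mcoeff_mdivX.
case: ifPn => [mv|mv]; first by rewrite submK // mnmU_le.
by apply/esym/eqP; apply: contraNT mv => /pv.
Qed.

Definition mset S : 'X_{1..n} := [multinom (i \in S : nat) | i < n].
Lemma msetE S i : mset S i = (i \in S). Proof. exact: mnmE. Qed.

End Monomials.

Section KoszulPoly.
Variables (n : nat) (K : fieldType).
Local Notation R := {mpoly K[n]}.
Implicit Types (m : 'X_{1..n}) (s v : 'I_n) (S T : {set 'I_n}) (Q : pred 'X_{1..n}).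
Local Notation Fun r := {ffun {set 'I_n} -> 'rV[R]_r}.

Definition koszulX {r} : Fun r -> Fun r := koszul (fun s => 'X_s).
HB.instance Definition _ r := GRing.Linear.on (@koszulX r).

Lemma koszulXE r (f : Fun r) T :
  koszulX f T = \sum_(s | s \notin T) ((-1) ^+ set_sign s T * 'X_s) *: f (s |: T).
Proof. by rewrite ffunE. Qed.

(** The basis element e_S carries multidegree [mset S], so a monomial m at S counts with multidegree
    [m + mset S]. This is the grading that [koszulX] preserves. *)
Definition mdeg_filt r Q (f : Fun r) : Fun r :=
  [ffun S : {set 'I_n} => map_mx (mfilt (fun m => Q (m + mset S)%MM)) (f S)].

Lemma mcoeff_mdeg_filt r Q (f : Fun r) S j m :
  (mdeg_filt Q f S 0 j)@_m = if Q (m + mset S)%MM then (f S 0 j)@_m else 0.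
Proof. by rewrite ffunE mxE mcoeff_mfilt. Qed.

Lemma funP r (f g : Fun r) : (forall S j m, (f S 0 j)@_m = (g S 0 j)@_m) -> f = g.
Proof. by move=> fg; apply/ffunP=> S; apply/rowP=> j; apply/mpolyP=> m. Qed.

Lemma mcoeff_sign (b : bool) (p : R) m : ((-1) ^+ b * p)@_m = (-1) ^+ b * p@_m.
Proof. by case: b; rewrite ?expr1 ?expr0 ?mul1r // !mulN1r mcoeffN. Qed.

Lemma mcoeff_koszulX r (f : Fun r) T j m : (koszulX f T 0 j)@_m =
  \sum_(s | s \notin T) (-1) ^+ set_sign s T *
     (if (0 < m s)%N then (f (s |: T) 0 j)@_(m - U_(s)) else 0).
Proof.
rewrite koszulXE summxE raddf_sum; apply: eq_bigr => s _ /=.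
by rewrite mxE -mulrA mcoeff_sign mcoeffXUM.
Qed.

Lemma mset_addU s T m : s \notin T -> (0 < m s)%N ->
  (m - U_(s) + mset (s |: T) = m + mset T)%MM.
Proof.
move=> sT ms; apply/mnmP=> i; rewrite !(mnmDE, mnmBE) !msetE mnm1E in_setU1.
have [->|_] := eqVneq i s; last by rewrite subn0.
by rewrite (negPf sT) addn0 subnK.
Qed.

Lemma koszulX_mfilt r Q (f : Fun r) : koszulX (mdeg_filt Q f) = mdeg_filt Q (koszulX f).
Proof.
apply: funP => T j m; rewrite mcoeff_mdeg_filt !mcoeff_koszulX.
case: ifPn => QT; last rewrite big1 //; last move=> s sT.
  apply: eq_bigr => s sT; case: ifP => // ms.
  by rewrite mcoeff_mdeg_filt mset_addU // QT.
case: ifP => [ms|_]; last by rewrite mulr0.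
by rewrite mcoeff_mdeg_filt mset_addU // (negPf QT) mulr0.
Qed.

Lemma mdeg_filt_sum r (O : finType) (w : 'X_{1..n} -> O) (f : Fun r) :
  f = \sum_o mdeg_filt (fun b => w b == o) f.
Proof.
apply: funP => S j m; rewrite sum_ffunE summxE raddf_sum /=.
rewrite (bigD1 (w (m + mset S)%MM)) //= mcoeff_mdeg_filt eqxx big1 ?addr0 // => o.
by rewrite eq_sym mcoeff_mdeg_filt => /negPf->.
Qed.

Lemma koszulX_htpyE r v (f : Fun r) :
    (forall S j m, v \notin S -> (f S 0 j)@_m != 0 -> (0 < m v)%N) ->
  koszulX (koszul_htpy (map_mx (mdivX v)) v f) + koszul_htpy (map_mx (mdivX v)) v
    (koszulX f) = f.
Proof.
move=> fv; apply/ffunP=> T; rewrite ffunE.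
rewrite (koszul_htpyE (q := map_mx (mdivX v)) (v := v)).
- case: ifPn => // vT; apply/rowP=> j; rewrite !mxE mdivX_mul // => m.
  exact: fv.
- by move=> s c sv; apply/rowP=> j; rewrite !mxE /= mdivXM.
by move=> c; apply/rowP=> j; rewrite !mxE /= mdivXK.
Qed.

(** The multidegrees are sorted by a variable that occurs in them, and each part is contracted in
    the direction of that variable. Multidegree 0 holds only constants at [set0], excluded by
    hypothesis. *)
Lemma koszulX_exact r (f : Fun r) : koszulX f = 0 -> (forall j, (f set0 0 j)@_0%MM = 0)
  ->
  exists g, f = koszulX g.
Proof.
move=> kf0 f0; pose w (b : 'X_{1..n}) := [pick v | (0 < b v)%N].
have flt0 Q : mdeg_filt Q (0 : Fun r) = 0.
  by apply: funP => S j m; rewrite mcoeff_mdeg_filt !ffunE !mxE mcoeff0 if_same.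
have kzh0 v : koszul_htpy (map_mx (mdivX v)) v (0 : Fun r) = 0.
  by apply/ffunP=> S; rewrite !ffunE; case: ifP => // _; rewrite !raddf0.
have fE v : mdeg_filt (fun b => w b == Some v) f =
    koszulX (koszul_htpy (map_mx (mdivX v)) v (mdeg_filt (fun b => w b == Some v) f)).
  rewrite -[LHS](@koszulX_htpyE _ v) => [|S j m vS].
    by rewrite koszulX_mfilt kf0 flt0 kzh0 addr0.
  rewrite mcoeff_mdeg_filt; case: ifPn; last by rewrite eqxx.
  rewrite /w; case: pickP => // u hu /eqP[uv] _; move: hu.
  by rewrite uv mnmDE msetE (negPf vS) addn0.
exists (\sum_v koszul_htpy (map_mx (mdivX v)) v (mdeg_filt (fun b => w b == Some v) f)).
rewrite [LHS](mdeg_filt_sum w) linear_sum (bigD1 None) //= [X in X + _](_ : _ = 0).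
  rewrite add0r (reindex_omap Some id) /=; last by case.
  by apply: eq_big => [v|v _]; [rewrite eqxx | exact: fE].
apply: funP => S j m; rewrite mcoeff_mdeg_filt !ffunE !mxE mcoeff0; case: ifP => //.
rewrite /w; case: pickP => // z _.
have m0 : m = 0%MM by apply/mnmP=> i; have := z i; rewrite mnmDE mnm0E; case: (m i).
have -> : S = set0.
  apply/setP=> i; rewrite inE; have := z i.
  by rewrite mnmDE msetE; case: (i \in S); rewrite // addn1.
by rewrite m0 f0.
Qed.
End KoszulPoly.

(** * Minimal resolutions and Koszul homology *)

Section Cochains.
Variables (n : nat) (K : fieldType).
Local Notation R := {mpoly K[n]}.
Local Notation Fun r := {ffun {set 'I_n} -> 'rV[R]_r}.
Implicit Types (S T : {set 'I_n}).

Definition ffun_mulmx r r' (D : 'M[R]_(r, r')) (f : Fun r) : Fun r' :=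
  [ffun S : {set 'I_n} => f S *m D].

Lemma ffun_mulmx_is_linear r r' (D : 'M[R]_(r, r')) : linear (ffun_mulmx D).
Proof.
by move=> c f g; apply/ffunP=> S; rewrite !ffunE mulmxDl scalemxAl.
Qed.
HB.instance Definition _ r r' (D : 'M[R]_(r, r')) :=
  GRing.isLinear.Build R (Fun r) (Fun r') _ (ffun_mulmx D) (ffun_mulmx_is_linear D).

Lemma koszulX_mulmx r r' (D : 'M[R]_(r, r')) f : koszulX (ffun_mulmx D f) = ffun_mulmx
  D (koszulX f).
Proof.
apply/ffunP=> T; rewrite koszulXE [RHS]ffunE koszulXE mulmx_suml.
by apply: eq_bigr => s _; rewrite ffunE scalemxAl.
Qed.

Lemma koszulXP r c (f g : Fun r) : koszulX (c *: f + g) = c *: koszulX f + koszulX g.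
Proof. exact: linearP. Qed.
Lemma koszulXD r (f g : Fun r) : koszulX (f + g) = koszulX f + koszulX g. Proof. exact:
  raddfD. Qed.
Lemma koszulXB r (f g : Fun r) : koszulX (f - g) = koszulX f - koszulX g. Proof. exact:
  raddfB. Qed.
Lemma koszulX0 r : koszulX (0 : Fun r) = 0. Proof. exact: raddf0. Qed.

Lemma ffun_mulmxP r r' (D : 'M[R]_(r, r')) c f g : ffun_mulmx D (c *: f + g) = c *:
  ffun_mulmx D f + ffun_mulmx D g.
Proof. exact: linearP. Qed.
Lemma ffun_mulmxD r r' (D : 'M[R]_(r, r')) f g : ffun_mulmx D (f + g) = ffun_mulmx D f
  + ffun_mulmx D g.
Proof. exact: raddfD. Qed.
Lemma ffun_mulmxB r r' (D : 'M[R]_(r, r')) f g : ffun_mulmx D (f - g) = ffun_mulmx D f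
  - ffun_mulmx D g.
Proof. exact: raddfB. Qed.
Lemma ffun_mulmx0 r r' (D : 'M[R]_(r, r')) : ffun_mulmx D 0 = 0. Proof. exact: raddf0.
  Qed.

Lemma koszulX_koszulX r (f : Fun r) : koszulX (koszulX f) = 0. Proof. exact:
  koszul_koszul. Qed.

Definition supp_on r k (f : Fun r) := forall S, #|S| != k -> f S = 0.

Definition layer r k (f : Fun r) : Fun r :=
  [ffun S : {set 'I_n} => if #|S| == k then f S else 0].

Lemma layer_supp r k (f : Fun r) : supp_on k (layer k f).
Proof. by move=> S /negPf Sk; rewrite ffunE Sk. Qed.

Lemma layer_id r k (f : Fun r) : supp_on k f -> layer k f = f.
Proof. by move=> fk; apply/ffunP=> S; rewrite ffunE; case: eqVneq => // /fk. Qed.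

Lemma layer_is_linear r k : linear (@layer r k).
Proof.
move=> c f g; apply/ffunP=> S; rewrite !ffunE; case: ifP => // _.
by rewrite scaler0 addr0.
Qed.
HB.instance Definition _ r k :=
  GRing.isLinear.Build R (Fun r) (Fun r) _ (@layer r k) (@layer_is_linear r k).

Lemma koszulX_layer r k (f : Fun r) : koszulX (layer k.+1 f) = layer k (koszulX f).
Proof.
apply/ffunP=> T; rewrite [RHS]ffunE !koszulXE; case: ifPn => Tk.
  by apply: eq_bigr => s sT; rewrite ffunE cardsU1 sT eqSS Tk.
rewrite big1 // => s sT.
by rewrite ffunE cardsU1 sT eqSS (negPf Tk) scaler0.
Qed.

Lemma koszulX_layer0 r (f : Fun r) : koszulX (layer 0 f) = 0.
Proof.
apply/ffunP=> T; rewrite koszulXE big1 ?ffunE // => s sT.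
by rewrite ffunE cardsU1 sT scaler0.
Qed.

Lemma ffun_mulmx_layer r r' (D : 'M[R]_(r, r')) k f : ffun_mulmx D (layer k f) = layer
  k (ffun_mulmx D f).
Proof. by apply/ffunP=> S; rewrite !ffunE; case: ifP; rewrite ?mul0mx. Qed.

Lemma supp_lin r k (c : R) (f g : Fun r) :
  supp_on k f -> supp_on k g -> supp_on k (c *: f + g).
Proof. by move=> sf sg S Sk; rewrite !ffunE sf // sg // scaler0 addr0. Qed.

Lemma fcoeffD r (f g : Fun r) S j m :
  ((f + g) S 0 j)@_m = (f S 0 j)@_m + (g S 0 j)@_m.
Proof. by rewrite ffunE mxE mcoeffD. Qed.

Lemma fcoeffB r (f g : Fun r) S j m :
  ((f - g) S 0 j)@_m = (f S 0 j)@_m - (g S 0 j)@_m.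
Proof. by rewrite ffunE mxE mcoeffD ffunE mxE mcoeffN. Qed.

Lemma supp0 r k : supp_on k (0 : Fun r). Proof. by move=> S _; rewrite ffunE. Qed.

(** Coefficients in the ideal of the variables. Both differentials of the double complex land here,
    the resolution by minimality, so constant terms survive modulo boundaries. *)
Definition in_max r (f : Fun r) := forall S j, (f S 0 j)@_0%MM = 0.

Lemma koszulX_in_max r (f : Fun r) : in_max (koszulX f).
Proof.
by move=> T j; rewrite mcoeff_koszulX big1 // => s _; rewrite mnm0E mulr0.
Qed.

Lemma ffun_mulmx_in_max r r' (D : 'M[R]_(r, r')) f :
  (forall i j, (D i j)@_0%MM = 0) -> in_max (ffun_mulmx D f).
Proof.
move=> D0 S j; rewrite ffunE mxE raddf_sum big1 //= => i _.
by rewrite rmorphM /= D0 mulr0.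
Qed.

Lemma koszulX_exact_max r (f : Fun r) : koszulX f = 0 -> in_max f -> exists g, f =
  koszulX g.
Proof. by move=> f0 fm; apply: koszulX_exact => // j; apply: fm. Qed.

End Cochains.

Section Staircase.
Variables (n : nat) (K : fieldType) (sz : nat -> nat).
Local Notation R := {mpoly K[n]}.
Local Notation Fun r := {ffun {set 'I_n} -> 'rV[R]_r}.
Variable d : forall a, 'M[R]_(sz a.+1, sz a).
Hypothesis d_exact : forall a (v : 'rV_(sz a.+1)), v *m d a = 0 <-> exists w, v = w *m
  d a.+1.
Hypothesis d_min : forall a j k, (d a j k)@_0%MM = 0.
Implicit Types (S T : {set 'I_n}) (z : nat -> K).

Definition im_d a (f : Fun (sz a)) := exists g, f = ffun_mulmx (d a) g.

Lemma im_dP a (f : Fun (sz a)) : (forall S, exists v, f S = v *m d a) -> im_d f.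
Proof.
case/fin_all_exists=> g fg; exists [ffun S => g S].
by apply/ffunP=> S; rewrite !ffunE.
Qed.

Lemma ffun_mulmx_dd a (f : Fun (sz a.+2)) : ffun_mulmx (d a) (ffun_mulmx (d a.+1) f) =
  0.
Proof.
apply/ffunP=> S; rewrite !ffunE; apply/d_exact; by exists (f S).
Qed.

Lemma ffun_mulmx_d_exact a (f : Fun (sz a.+1)) : ffun_mulmx (d a) f = 0 -> im_d f.
Proof.
move=> /ffunP f0; apply: im_dP => S; apply/d_exact.
by have := f0 S; rewrite !ffunE.
Qed.

Lemma d_in_max a (f : Fun (sz a.+1)) : in_max (ffun_mulmx (d a) f).
Proof. by apply: ffun_mulmx_in_max; apply: d_min. Qed.

(* Constants are indexed by nat, rather than by 'I_(sz a), so that the levels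
   (a, j) of a zigzag with the same a + j share one type of constants. *)
Definition cst a z : Fun (sz a) :=
  [ffun S => if S == set0 then \row_(j < sz a) (z j)%:MP else 0].

(* The zigzag of the double complex of a resolution and the Koszul complex:
   it leads from w in homological degree a down to constants z in degree a + j. *)
Fixpoint zigzag j a : Fun (sz a) -> (nat -> K) -> Prop :=
  match j with
  | 0 => fun w z => exists y y', w = cst a z + koszulX y + ffun_mulmx (d a) y'
  | j'.+1 => fun w z =>
      exists w', [/\ supp_on j' w', koszulX w = ffun_mulmx (d a) w' & @zigzag j' a.+1
        w' z]
  end.

Lemma cst_lin a (c : K) z z' :
  cst a (fun k => c * z k + z' k) = c%:MP *: cst a z + cst a z'.
Proof.
apply/ffunP=> S; rewrite !ffunE; case: ifP => _; last by rewrite scaler0 addr0.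
by apply/rowP=> j; rewrite !mxE mpolyCD mpolyCM.
Qed.

Lemma zigzag_lin j a (c : K) (w w' : Fun (sz a)) z z' :
  zigzag j w z -> zigzag j w' z' -> zigzag j (c%:MP *: w + w')
    (fun k => c * z k + z' k).
Proof.
elim: j a w w' => [|j IHj] a w w' /=.
  move=> [y [y' ->]] [x [x' ->]]; exists (c%:MP *: y + x), (c%:MP *: y' + x').
  rewrite cst_lin koszulXP ffun_mulmxP !scalerDr addrACA; congr (_ + _).
  exact: addrACA.
move=> [v [sv kv zv]] [v' [sv' kv' zv']]; exists (c%:MP *: v + v'); split.
- exact: supp_lin.
- by rewrite koszulXP ffun_mulmxP kv kv'.
exact: IHj.
Qed.

(** Built from the constants upwards: the image of w' under [d a] is a Koszul cycle without constant
    terms, by minimality, hence a Koszul boundary. *)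
Lemma zigzag_exists j a z : exists w : Fun (sz a),
  [/\ supp_on j w, im_d (koszulX w) & zigzag j w z].
Proof.
elim: j a => [|j IHj] a.
  exists (cst a z); split.
  - by move=> S; rewrite cards_eq0 ffunE => /negPf->.
  - exists 0; rewrite ffun_mulmx0 -[cst a z](@layer_id _ _ _ 0) ?koszulX_layer0 //.
    by move=> S; rewrite cards_eq0 ffunE => /negPf->.
  by exists 0, 0; rewrite koszulX0 ffun_mulmx0 !addr0.
have [w' [sw' [v kw'] zw']] := IHj a.+1.
have [w dw] : exists w, ffun_mulmx (d a) w' = koszulX w.
  apply: koszulX_exact_max; last exact: d_in_max.
  by rewrite koszulX_mulmx kw' ffun_mulmx_dd.
exists (layer j.+1 w); split; first exact: layer_supp.
  by exists w'; rewrite koszulX_layer -dw -ffun_mulmx_layer layer_id.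
by exists w'; split; rewrite // koszulX_layer -dw -ffun_mulmx_layer layer_id.
Qed.

(** Exactness of the resolution gives each next level; at the last one the constant terms at [set0]
    are read off, and the rest is a Koszul boundary. *)
Lemma zigzag_surj j a (w : Fun (sz a)) : supp_on j w -> im_d (koszulX w) ->
  exists z, zigzag j w z.
Proof.
elim: j a w => [|j IHj] a w sw [v kw].
  pose z k := if insub k is Some i then (w set0 0 i)@_0%MM else 0 : K.
  have [y wy] : exists y, w - cst a z = koszulX y.
    apply: koszulX_exact_max.
      rewrite koszulXB -[w](layer_id sw) koszulX_layer0 -[cst a z](@layer_id _ _ _ 0).
        by rewrite koszulX_layer0 subr0.
      by move=> S; rewrite cards_eq0 ffunE => /negPf->.
    move=> S i; rewrite !ffunE; have [->|S0] := eqVneq S set0.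
      by rewrite !mxE mcoeffB /z valK mcoeffC eqxx mulr1 subrr.
    by rewrite sw ?cards_eq0 // subr0 mxE mcoeff0.
  by exists z, y, 0; rewrite ffun_mulmx0 addr0 -wy addrCA subrr addr0.
have kdv : ffun_mulmx (d a) (layer j v) = koszulX w.
  by rewrite ffun_mulmx_layer -kw -koszulX_layer layer_id.
have [z zv] : exists z, zigzag j (layer j v) z.
  apply: IHj; first exact: layer_supp.
  by apply: ffun_mulmx_d_exact; rewrite -koszulX_mulmx kdv koszulX_koszulX.
by exists z, (layer j v); split=> //; apply: layer_supp.
Qed.

(** Being a boundary passes to the next level, since w' - [koszulX y'] is killed by [d a]. At the
    last level boundaries have no constant terms. *)
Lemma zigzag_inj j a (w : Fun (sz a)) z y y' : zigzag j w z ->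
  w = koszulX y + ffun_mulmx (d a) y' -> forall k, (k < sz (a + j)%N)%N -> z k = 0.
Proof.
elim: j a w y y' => [|j IHj] a w y y' /=.
  rewrite addn0 => -[x [x' ->]] e k ka.
  have := congr1 (fun f : Fun _ => (f set0 0 (Ordinal ka))@_0%MM) e.
  rewrite !fcoeffD !koszulX_in_max !d_in_max !addr0 ffunE eqxx mxE mcoeffC eqxx mulr1.
  by [].
move=> [w' [_ kw zw']] we; rewrite addnS -addSn.
have [y'' e] : im_d (w' - koszulX y').
  apply: ffun_mulmx_d_exact; rewrite ffun_mulmxB -koszulX_mulmx -kw we koszulXD
    koszulX_koszulX add0r.
  by rewrite subrr.
by apply: (IHj _ _ y' y'' zw'); rewrite -e addrC subrK.
Qed.

Lemma zigzag_im j a (w : Fun (sz a)) z : supp_on j w -> zigzag j w z ->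
  (forall k, (k < sz (a + j)%N)%N -> z k = 0) -> exists y y', w = koszulX y +
    ffun_mulmx (d a) y'.
Proof.
elim: j a w => [|j IHj] a w sw /=.
  move=> [y [y' ->]] z0; exists y, y'; rewrite (_ : cst a z = 0) ?add0r //.
  apply/ffunP=> S; rewrite !ffunE; case: ifP => // _; apply/rowP=> k; rewrite !mxE.
  by rewrite z0 ?addn0 // mpolyC0.
move=> [w' [sw' kw zw']] z0.
have [y [y' we]] : exists y y', w' = koszulX y + ffun_mulmx (d a.+1) y'.
  by apply: IHj zw' _ => // k; rewrite addSnnS; apply: z0.
have [x wx] : exists x, w - ffun_mulmx (d a) y = koszulX x.
  apply: koszulX_exact => [|i].
    by rewrite koszulXB kw we ffun_mulmxD ffun_mulmx_dd addr0 koszulX_mulmx subrr.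
  by rewrite fcoeffB d_in_max subr0 sw ?cards0 // mxE mcoeff0.
by exists x, y; rewrite -wx subrK.
Qed.

Section Augmented.
Variables (I : {mpoly K[n]} -> Prop) (aug : 'M[R]_(sz 0, 1)).
Hypothesis I0 : I 0.
Hypothesis ID : forall p q, I p -> I q -> I (p + q).
Hypothesis IM : forall p q, I q -> I (p * q).
Hypothesis aug_surj : forall p, exists v : 'rV_(sz 0), I (p - (v *m aug) 0 0).
Hypothesis aug_exact : forall v : 'rV_(sz 0),
  I ((v *m aug) 0 0) <-> exists w, v = w *m d 0.

Definition inI (c : Fun 1) := forall S, I (c S 0 0).
Definition bdI (c : Fun 1) := exists y i, inI i /\ c = koszulX y + i.

Lemma inI_lin (c : R) f g : inI f -> inI g -> inI (c *: f + g).
Proof.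
by move=> If Ig S; rewrite ffunE mxE ffunE mxE; apply: ID => //; apply: IM.
Qed.

Lemma inI_koszulX f : inI f -> inI (koszulX f).
Proof.
move=> If T; rewrite koszulXE summxE; apply: big_ind => // s _.
by rewrite mxE; apply: IM.
Qed.

Lemma inI_aug (w : Fun (sz 0)) : inI (ffun_mulmx aug w) <-> im_d w.
Proof.
split=> [Iw|[v ->] S].
  by apply: im_dP => S; apply/aug_exact; have := Iw S; rewrite ffunE.
by rewrite !ffunE; apply/aug_exact; exists (v S).
Qed.

Lemma aug_lift (c : Fun 1) : exists w, inI (c - ffun_mulmx aug w).
Proof.
have [w cw] := fin_all_exists (fun S => aug_surj (c S 0 0)).
by exists [ffun S => w S] => S; have := cw S; rewrite !ffunE !mxE.
Qed.

Lemma inI0 : inI 0. Proof. by move=> S; rewrite ffunE mxE. Qed.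

Lemma inID f g : inI f -> inI g -> inI (f + g).
Proof. by move=> If Ig S; rewrite ffunE mxE; apply: ID. Qed.

Lemma inIN f : inI f -> inI (- f).
Proof. by move=> If S; rewrite ffunE mxE -mulN1r; apply: IM. Qed.

Lemma inI_layer k f : inI f -> inI (layer k f).
Proof. by move=> If S; rewrite ffunE; case: ifP => // _; rewrite mxE. Qed.

(* The isomorphism between K^(sz i) and the i-th Koszul homology of R/I, as a
   relation between constants and representing cycles. *)
Definition tor_rel i (c : Fun 1) z :=
  exists w, [/\ supp_on i w, zigzag i w z & inI (c - ffun_mulmx aug w)].

Lemma tor_rel_lin i (a : K) c c' z z' : tor_rel i c z -> tor_rel i c' z' ->
  tor_rel i (a%:MP *: c + c') (fun k => a * z k + z' k).
Proof.
move=> [w [sw zw Iw]] [w' [sw' zw' Iw']]; exists (a%:MP *: w + w'); split.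
- exact: supp_lin.
- exact: zigzag_lin.
have -> : a%:MP *: c + c' - ffun_mulmx aug (a%:MP *: w + w') =
    a%:MP *: (c - ffun_mulmx aug w) + (c' - ffun_mulmx aug w').
  by rewrite ffun_mulmxP scalerBr opprD; apply: addrACA.
exact: inI_lin.
Qed.

(** With the three lemmas that follow, the linear relation is total on both sides, and boundaries
    correspond exactly to zero constants: an isomorphism. *)
Lemma tor_rel_exists i z : exists c, [/\ supp_on i c, inI (koszulX c) & tor_rel i c z].
Proof.
have [w [sw [v kw] zw]] := zigzag_exists i 0 z.
exists (ffun_mulmx aug w); split.
- by rewrite -(layer_id sw) ffun_mulmx_layer; apply: layer_supp.
- by rewrite koszulX_mulmx; apply/inI_aug; exists v.
by exists w; split; rewrite // subrr; apply: inI0.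
Qed.

Lemma tor_rel_surj i c : supp_on i c -> inI (koszulX c) -> exists z, tor_rel i c z.
Proof.
move=> sc Ic; have [w0 Iw0] := aug_lift c; pose w := layer i w0.
have Iw : inI (c - ffun_mulmx aug w).
  by rewrite /w ffun_mulmx_layer -(layer_id sc) -raddfB; apply: inI_layer.
have sw : supp_on i w by apply: layer_supp.
have [z zw] : exists z, zigzag i w z.
  apply: zigzag_surj => //; apply/inI_aug; rewrite -koszulX_mulmx.
  have -> : ffun_mulmx aug w = c - (c - ffun_mulmx aug w) by rewrite opprB addrC subrK.
  by rewrite koszulXB; apply: inID => //; apply: inIN; apply: inI_koszulX.
by exists z, w.
Qed.

Lemma tor_rel_inj i c z : tor_rel i c z -> bdI c -> forall k, (k < sz i)%N -> z k = 0.
Proof.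
move=> [w [sw zw Iw]] [y [u [Iu cy]]]; have [y0 Iy0] := aug_lift y.
have [y' wy] : im_d (w - koszulX y0).
  apply/inI_aug; rewrite ffun_mulmxB -koszulX_mulmx.
  have -> : ffun_mulmx aug w - koszulX (ffun_mulmx aug y0) = u + koszulX
    (y - ffun_mulmx aug y0) - (c - ffun_mulmx aug w).
    have zid (A B U X : Fun 1) : X - B = U + (A - B) - (A + U - X).
      by rewrite opprB [U + (A - B)]addrA [U + A]addrC [RHS]addrC [RHS]addrA subrK.
    by rewrite koszulXB cy; apply: zid.
  apply: inID; last exact: inIN.
  by apply: inID => //; apply: inI_koszulX.
have we : w = koszulX y0 + ffun_mulmx (d 0) y' by rewrite -wy addrC subrK.
exact: zigzag_inj zw we.
Qed.

Lemma tor_rel_bd i c z : supp_on i c -> tor_rel i c z ->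
  (forall k, (k < sz i)%N -> z k = 0) -> bdI c.
Proof.
move=> sc [w [sw zw Iw]] z0; have [y [y' we]] := zigzag_im sw zw z0.
exists (ffun_mulmx aug y), (ffun_mulmx aug (ffun_mulmx (d 0) y') +
  (c - ffun_mulmx aug w)); split.
  by apply: inID => //; apply/inI_aug; exists y'.
by rewrite addrA koszulX_mulmx -ffun_mulmxD -we addrC subrK.
Qed.
End Augmented.
End Staircase.

(** * Hochster's formula *)

Section Hochster.
Variables (n : nat) (K : fieldType) (e : rel 'I_n).
Local Notation R := {mpoly K[n]}.
Local Notation Fun r := {ffun {set 'I_n} -> 'rV[R]_r}.
Local Notation N := #|{set 'I_n}|.
Local Notation coface := (coface e).
Implicit Types (S T W : {set 'I_n}) (m : 'X_{1..n}) (x y : 'rV[K]_N).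

Definition msup m : {set 'I_n} := [set i | (0 < m i)%N].
(** The Stanley-Reisner ideal described by its monomials, so that membership can be tested
    coefficient by coefficient; [sr_idealE] justifies it. *)
Definition nonface_ideal (p : R) := forall m, p@_m != 0 -> ~~ indep e (msup m).
Local Notation I := nonface_ideal.

Lemma nfi0 : I 0. Proof. by move=> m; rewrite mcoeff0 eqxx. Qed.

Lemma nfiD p q : I p -> I q -> I (p + q).
Proof.
move=> Ip Iq m; rewrite mcoeffD; have [p0|/Ip //] := eqVneq p@_m 0.
by rewrite p0 add0r; apply: Iq.
Qed.

Lemma nfiM p q : I q -> I (p * q).
Proof.
move=> Iq m; rewrite -mcoeff_msupp => /msuppM_le /allpairsP[[m1 m2] /= [_ m2q ->]].
apply: contra (Iq m2 _); last by rewrite -mcoeff_msupp.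
apply: indepS; apply/subsetP=> i; rewrite !inE mnmDE => h.
by rewrite (leq_trans h) ?leq_addl.
Qed.

Lemma fcoeffCZ r (a : K) (f : Fun r) S j m :
  ((a%:MP *: f) S 0 j)@_m = a * (f S 0 j)@_m.
Proof. by rewrite ffunE mxE mcoeffCM. Qed.

(** The part of multidegree W of the Koszul complex of R/I has the basis X^(W - S) e_S, S a coface.
    [sqf_emb] and [sqf_proj] identify it with row vectors. *)
Definition sqf_emb W x : Fun 1 :=
  [ffun S => if coface W S then const_mx ((x 0 (enum_rank S)) *: 'X_[mset (W :\: S)])
    else 0].

Definition sqf_proj W (c : Fun 1) : 'rV[K]_N :=
  let F S := if coface W S then (c S 0 0)@_(mset (W :\: S)) else 0 in \row_b F
    (enum_val b).

Lemma mcoeff_emb W x S m : (sqf_emb W x S 0 0)@_m =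
  if coface W S && (m == mset (W :\: S)) then x 0 (enum_rank S) else 0.
Proof.
rewrite ffunE; case: ifP => _ /=; rewrite mxE ?mcoeff0 // mcoeffZ mcoeffX eq_sym.
by case: eqP; rewrite ?mulr1 ?mulr0.
Qed.

Lemma projE W c S : sqf_proj W c 0 (enum_rank S) =
  if coface W S then (c S 0 0)@_(mset (W :\: S)) else 0.
Proof. by rewrite mxE enum_rankK. Qed.

Lemma rowNP x y : (forall S, x 0 (enum_rank S) = y 0 (enum_rank S)) -> x = y.
Proof. by move=> xy; apply/rowP=> b; rewrite -(enum_valK b). Qed.

Lemma mul_prmxE x (P : pred {set 'I_n}) S :
  (x *m prmx K P) 0 (enum_rank S) = if P S then x 0 (enum_rank S) else 0.
Proof.
by rewrite /prmx mul_mx_diag !mxE enum_rankK; case: (P S); rewrite ?mulr1 ?mulr0.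
Qed.

Lemma mul_fbdmxE x (P : pred {set 'I_n}) T :
  (x *m fbdmx K P) 0 (enum_rank T) = if P T then
     \sum_(s | s \notin T) (-1) ^+ set_sign s T *
       (if P (s |: T) then x 0 (enum_rank (s |: T)) else 0)
   else 0.
Proof.
rewrite fbdmxE !mulmxA mul_prmxE; case: ifP => // _.
have /ffunP/(_ T) := row_bdmx (x *m prmx K P); rewrite ffunE => ->.
rewrite ffunE; apply: eq_bigr => s _.
by rewrite ffunE mul_prmxE mulr1.
Qed.

Lemma mset_inj : injective (@mset n).
Proof. by move=> S T ST; apply/setP=> i; have := congr1 (fun m : 'X_{1..n} => m i) ST;
  rewrite !msetE; case: (i \in S); case: (i \in T). Qed.

Lemma msup_mset S : msup (mset S) = S.
Proof. by apply/setP=> i; rewrite inE msetE lt0b. Qed.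

Lemma mset_subU s T W m : s \notin T -> s \in W ->
  ((0 < m s)%N && (m - U_(s) == mset (W :\: (s |: T)))%MM) = (m == mset (W :\: T)).
Proof.
move=> sT sW; apply/andP/eqP => [[ms /eqP E]|->].
  have := submK (m := U_(s)) (m' := m); rewrite mnmU_le => /(_ ms) <-; rewrite E.
  apply/mnmP=> i; rewrite mnmDE !msetE !inE mnm1E.
  by have [<-|_] := eqVneq s i; rewrite ?sT ?sW ?addn0.
rewrite msetE inE sT sW; split=> //; apply/eqP/mnmP=> i.
rewrite mnmBE !msetE !inE mnm1E.
by have [<-|_] := eqVneq s i; rewrite ?sT ?sW ?subn0.
Qed.

Lemma coface_sub1 W s T : coface W (s |: T) -> s \in W.
Proof. by move=> /andP[/subsetP h _]; apply: h; rewrite setU11. Qed.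

Lemma proj_koszulX W (y : Fun 1) : sqf_proj W (koszulX y) = sqf_proj W y *m fbdmx K
  (coface W).
Proof.
apply: rowNP => T; rewrite projE mul_fbdmxE; case: ifP => // fT.
rewrite mcoeff_koszulX; apply: eq_bigr => s sT; congr (_ * _).
rewrite projE msetE inE sT /=.
have [sW|sW] := boolP (s \in W); last first.
  by case: ifP => // /coface_sub1; rewrite (negPf sW).
have sWT : s |: T \subset W by rewrite subUset sub1set sW; case/andP: fT.
rewrite (coface_up (subsetUr _ _) fT sWT).
have := mset_subU (mset (W :\: T)) sT sW; rewrite eqxx => /andP[_ /eqP E].
by rewrite /= -E.
Qed.

(** Equality fails only at sets T inside W that are not cofaces; there the monomial of W - T has a
    nonface as support and lies in I. *)
Lemma koszulX_emb W x : inI I (koszulX (sqf_emb W x) - sqf_emb W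
  (x *m fbdmx K (coface W))).
Proof.
move=> T m; rewrite fcoeffB mcoeff_koszulX mcoeff_emb mul_fbdmxE.
have [mW|mW] := eqVneq m (mset (W :\: T)); last first.
  rewrite andbF subr0 big1 ?eqxx // => s sT; rewrite mcoeff_emb.
  case: ifP => ms; rewrite ?mulr0 //; case: ifP => [/andP[fs e1]|]; rewrite ?mulr0 //.
  by case/negP: mW; rewrite -(mset_subU _ sT (coface_sub1 fs)) ms.
have term s : s \notin T -> (if (0 < m s)%N then
  (sqf_emb W x (s |: T) 0 0)@_(m - U_(s)) else 0) =
    if coface W (s |: T) then x 0 (enum_rank (s |: T)) else 0.
  move=> sT; rewrite mcoeff_emb; case: (boolP (coface W (s |: T))) => [fs|];
    last by rewrite if_same.
  have := mset_subU m sT (coface_sub1 fs); rewrite mW eqxx => /andP[-> ->].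
  by [].
rewrite (eq_bigr _ (fun s sT => congr1 _ (term s sT))) andbT; case: ifPn => fT.
  by rewrite ?fT subrr eqxx.
rewrite mW msup_mset ?(negPf fT) subr0; case: (boolP (T \subset W)) => TW.
  by move=> _; move: fT; rewrite cofaceE TW.
rewrite big1 ?eqxx // => s sT; case: ifP => [/andP[sTW _]|]; last by rewrite mulr0.
by case/negP: TW; apply: subset_trans sTW; apply: subsetUr.
Qed.

Lemma proj_emb W W' x : sqf_proj W' (sqf_emb W x) = if W' == W then x *m prmx K
  (coface W) else 0.
Proof.
apply: rowNP => S; rewrite projE mcoeff_emb (inj_eq mset_inj).
have [<-|WW'] := eqVneq W' W.
  by rewrite eqxx andbT mul_prmxE; case: (coface W' S).
rewrite mxE; case: ifP => // /andP[SW' _]; case: ifP => // /andP[/andP[SW _] /eqP e1].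
by case/eqP: WW'; rewrite -(setID W S) -(setID W' S) e1 (setIidPr SW) (setIidPr SW').
Qed.

Lemma proj_inI W c : inI I c -> sqf_proj W c = 0.
Proof.
move=> Ic; apply: rowNP => S; rewrite projE mxE; case: ifP => // fS.
apply/eqP; apply: contraTT isT => /(Ic S); rewrite msup_mset.
by case/andP: fS => _ ->.
Qed.

Lemma proj_is_linear W : forall (a : K) c c',
  sqf_proj W (a%:MP *: c + c') = a *: sqf_proj W c + sqf_proj W c'.
Proof.
move=> a c c'; apply: rowNP => S; rewrite projE mxE [in RHS]mxE !projE.
case: ifP => _; last by rewrite mulr0 addr0.
by rewrite fcoeffD fcoeffCZ.
Qed.

Lemma emb_is_linear W (a : K) x y :
  sqf_emb W (a *: x + y) = a%:MP *: sqf_emb W x + sqf_emb W y.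
Proof.
apply: funP => S j m; rewrite (ord1 j) fcoeffD fcoeffCZ !mcoeff_emb.
by case: ifP => _; rewrite ?mulr0 ?addr0 // !mxE.
Qed.

Lemma emb_supp W i x : x *m prmx K (lay (coface W) i) = x -> supp_on i (sqf_emb W x).
Proof.
move=> xl S Si; rewrite ffunE; case: ifP => // _; apply/matrixP=> a j.
by rewrite -xl mul_prmxE /lay /= (negPf Si) andbF scale0r !mxE.
Qed.

Lemma proj_supp W i c : supp_on i c -> sqf_proj W c *m prmx K (lay (coface W) i) =
  sqf_proj W c.
Proof.
move=> sc; apply: rowNP => S; rewrite mul_prmxE projE /lay /= -/(coface W S).
case: eqVneq => Si; first by rewrite andbT; case: (coface W S).
by rewrite andbF sc // mxE mcoeff0 if_same.
Qed.

(* The part of c in multidegrees where some variable v has exponent at least 2 is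
   a boundary modulo I, by the homotopy in direction v. *)
Lemma bdI_reconstruct (c : Fun 1) : inI I (koszulX c) ->
  bdI I (c - \sum_W sqf_emb W (sqf_proj W c)).
Proof.
move=> Ic; pose w (b : 'X_{1..n}) := [pick v | (1 < b v)%N].
pose c_ v := mdeg_filt (fun b => w b == Some v) c.
pose h v := koszul_htpy (map_mx (mdivX v)) v : Fun 1 -> Fun 1.
have cE v : c_ v = koszulX (h v (c_ v)) + h v (koszulX (c_ v)).
  rewrite koszulX_htpyE // => S j m vS; rewrite mcoeff_mdeg_filt; case: ifPn;
    last by rewrite eqxx.
  rewrite /w; case: pickP => // u hu /eqP[uv] _; move: hu.
  by rewrite uv mnmDE msetE (negPf vS) addn0; apply: ltnW.
exists (\sum_v h v (c_ v)), (\sum_v h v (koszulX (c_ v)) +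
   (mdeg_filt (fun b => w b == None) c - \sum_W sqf_emb W (sqf_proj W c))); split.
  apply: inID; first exact: nfiD.
    apply: (big_ind (inI I)) => [|f g|v _];
      [exact: inI0 nfi0|by apply: inID; apply: nfiD|].
    (* The exponent 2 matters here: dividing by X_v still leaves a factor X_v, so the support of the
       monomial is unchanged and the result stays in I. *)
    move=> T m; rewrite ffunE; case: ifP => vT; last by rewrite mxE mcoeff0 eqxx.
    rewrite mxE mcoeff_sign !mxE mcoeff_mdivX => nz.
    have {nz} : ((koszulX (c_ v) (T :\ v)) 0 0)@_(m + U_(v)) != 0.
      by apply: contraNneq nz => ->; rewrite mulr0.
    rewrite koszulX_mfilt mcoeff_mdeg_filt; case: ifPn => [|_]; last by rewrite eqxx.
    rewrite /w; case: pickP => // u hu /eqP[uv]; move: hu; rewrite uv => mv /Ic.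
    apply: contra; apply: indepS; apply/subsetP=> i; rewrite !inE mnmDE mnm1E.
    case: eqVneq => [<- _|_]; last by rewrite addn0.
    by move: mv; rewrite !mnmDE mnm1E eqxx msetE !inE eqxx addn0 addn1 ltnS.
  move=> S m; rewrite fcoeffB mcoeff_mdeg_filt sum_ffunE summxE raddf_sum /=.
  under eq_bigr => W _ do rewrite mcoeff_emb projE.
  have [[W0 fW0 mW0]|no] : (exists2 W0, coface W0 S & m = mset (W0 :\: S)) \/
      (forall W, coface W S && (m == mset (W :\: S)) = false).
    have [W0 /andP[f0 /eqP m0]|no] := pickP
      (fun W => coface W S && (m == mset (W :\: S))).
      by left; exists W0.
    by right.
    rewrite (bigD1 W0) //= fW0 mW0 eqxx big1 ?addr0 => [|W WW0].
      have -> : w (mset (W0 :\: S) + mset S)%MM = None.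
        rewrite /w; case: pickP => // i; rewrite mnmDE !msetE inE.
        by case: (i \in S); case: (i \in W0).
      by rewrite eqxx subrr eqxx.
    case: ifP => // /andP[/andP[SW _]]; rewrite (inj_eq mset_inj) => /eqP e1.
    case/eqP: WW0; have /andP[SW0 _] := fW0.
    by rewrite -(setID W S) -(setID W0 S) e1 (setIidPr SW) (setIidPr SW0).
  rewrite big1 => [|W _]; last by rewrite no.
  rewrite subr0; case: ifPn => [|_]; last by rewrite eqxx.
  rewrite /w; case: pickP => // small _ _; apply/negP=> im.
  have disj i : i \in S -> m i = 0%N.
    by move=> iS; have := small i;
      rewrite mnmDE msetE iS addn1 ltnS lt0n => /negbFE/eqP.
  (* All exponents of the multidegree are at most 1, so m is squarefree and disjoint from S. Were
     its support a face, W = [msup m :|: S] would fit, against [no]. *)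
  have := no (msup m :|: S); rewrite cofaceE subsetUr /=.
  have -> : (msup m :|: S) :\: S = msup m.
    apply/setP=> i; rewrite !inE; case: (boolP (i \in S)) => [/disj->|] //=.
    by rewrite orbF.
  rewrite im /= => /eqP; apply; apply/mnmP=> i; rewrite msetE inE.
  by have := small i; rewrite mnmDE; case: (m i) => [|[|k]].
rewrite addrA addrA; congr (_ - _);
  rewrite [LHS](mdeg_filt_sum w) (bigD1 None) //= addrC.
congr (_ + _); rewrite raddf_sum -big_split /= (reindex_omap Some id) /=; last by case.
by apply: eq_big => [v|v _]; [rewrite eqxx | exact: cE].
Qed.
End Hochster.

(** * Ranks of the resolution as sums of dimensions over all W *)

Section Count.
Variables (n : nat) (K : fieldType) (e : rel 'I_n) (i : nat).
Local Notation N := #|{set 'I_n}|.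
Local Notation coface := (coface e).
Local Notation R := {mpoly K[n]}.
Local Notation Fun r := {ffun {set 'I_n} -> 'rV[R]_r}.
Implicit Types (W : {set 'I_n}).

Definition cyc W : 'M[K]_N := (prmx K (lay (coface W) i) :&: kermx
  (fbdmx K (coface W)))%MS.
Definition bnd W : 'M[K]_N := lay_bdmx K (coface W) i.+1.
Definition hom W : 'M[K]_N := (cyc W :\: bnd W)%MS.

Lemma bnd_cyc W : (bnd W <= cyc W)%MS.
Proof. exact/lay_bdmx_ker/coface_convex. Qed.

Lemma rank_hom W : \rank (hom W) = hbetti e K W i.
Proof.
have cap := mxrank_cap_compl (cyc W) (bnd W); move: cap.
have -> : \rank (cyc W :&: bnd W)%MS = bd_rank K (coface W) i.+1.
  by rewrite (capmx_idPr (bnd_cyc W)).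
have ker : (bd_rank K (coface W) i + \rank (cyc W))%N = lay_card (coface W) i :=
  rank_ker_lay _ _ _.
by move=> cap; rewrite /hbetti /hdim -ker -cap !addKn.
Qed.

Lemma cyc_hom W (x : 'rV_N) : (x <= cyc W)%MS ->
  exists u v, x = u *m row_base (hom W) + v *m bnd W.
Proof.
rewrite -(addsmx_diff_cap_eq (cyc W) (bnd W)) => /sub_addsmxP[[u v] /= ->].
have /submxP[u' ->] : (u *m hom W <= row_base (hom W))%MS.
  by rewrite eq_row_base submxMl.
have /submxP[v' ->] : (v *m (cyc W :&: bnd W)%MS <= bnd W)%MS.
  by rewrite (submx_trans (submxMl _ _)) // capmxSr.
by exists u', v'.
Qed.

Lemma hom_free W (u : 'rV_(\rank (hom W))) : (u *m row_base (hom W) <= bnd W)%MS -> u =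
  0.
Proof.
move=> uB; apply: (row_free_inj (row_base_free (hom W))); rewrite mul0mx.
apply/eqP; rewrite -submx0 -(capmx_diff (cyc W) (bnd W)) sub_capmx uB andbT.
by rewrite -/(hom W) -(eq_row_base (hom W)) submxMl.
Qed.

Lemma hom_cyc W (u : 'rV_(\rank (hom W))) : (u *m row_base (hom W) <= cyc W)%MS.
Proof.
by rewrite (submx_trans (submxMl _ _)) // eq_row_base diffmxSl.
Qed.

Variables (sz : nat -> nat) (d : forall a, 'M[R]_(sz a.+1, sz a)).
Hypothesis d_exact : forall a (v : 'rV_(sz a.+1)), v *m d a = 0 <-> exists w, v = w *m
  d a.+1.
Hypothesis d_min : forall a j k, (d a j k)@_0%MM = 0.
Variable aug : 'M[R]_(sz 0, 1).
Local Notation I := (nonface_ideal (K := K) e).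
Hypothesis aug_surj : forall p, exists v : 'rV_(sz 0), I (p - (v *m aug) 0 0).
Hypothesis aug_exact : forall v : 'rV_(sz 0),
  I ((v *m aug) 0 0) <-> exists w, v = w *m d 0.

Local Notation rel := (tor_rel d I aug i).
Local Notation nfi0 := (@nfi0 n K e).
Local Notation nfiD := (@nfiD n K e).
Local Notation nfiM := (@nfiM n K e).

Let J : finType := {W : {set 'I_n} & 'I_(\rank (hom W))}.
Let cl (j : J) : Fun 1 := sqf_emb e (tag j) (row (tagged j) (row_base (hom (tag j)))).

Lemma emb0 W : sqf_emb e W (0 : 'rV[K]_N) = 0.
Proof.
by apply: funP => S j m; rewrite (ord1 j) mcoeff_emb mxE if_same ffunE mxE mcoeff0.
Qed.

Lemma emb_lin_sum W r (a : 'I_r -> K) (x : 'I_r -> 'rV[K]_N) :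
  sqf_emb e W (\sum_k a k *: x k) = \sum_k (a k)%:MP *: sqf_emb e W (x k).
Proof.
elim/big_rec2: _ => [|k f y _ <-]; [exact: emb0 | exact: emb_is_linear].
Qed.

Lemma proj_lin_sum (T : finType) W (a : T -> K) (c : T -> Fun 1) :
  sqf_proj e W (\sum_k (a k)%:MP *: c k) = \sum_k a k *: sqf_proj e W (c k).
Proof.
elim/big_rec2: _ => [|k f y _ <-]; last exact: proj_is_linear.
by rewrite proj_inI //; apply: inI0 nfi0.
Qed.

Lemma rel_sum (T : finType) (a : T -> K) (c : T -> Fun 1) (z : T -> nat -> K) :
  (forall k, rel (c k) (z k)) ->
  exists2 y, rel (\sum_k (a k)%:MP *: c k) y & forall t, y t = \sum_k a k * z k t.
Proof.
move=> cz.
suff : forall s : seq T, exists2 y, rel (\sum_(k <- s) (a k)%:MP *: c k) y &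
    forall t, y t = \sum_(k <- s) a k * z k t.
  by move/(_ (index_enum T)).
elim=> [|k s [y ry yE]].
  have [c0 [_ _ r0]] := tor_rel_exists d_exact d_min nfi0 aug_exact i (fun=> 0).
  (* The zero relation is obtained as -c0 + c0, so its constants come unsimplified; claiming the
     values only pointwise avoids functional extensionality. *)
  exists (fun=> -1 * 0 + 0) => [|t]; last by rewrite big_nil mulr0 addr0.
  have c00 : (-1)%:MP *: c0 + c0 = 0 by rewrite mpolyCN mpolyC1 scaleN1r addNr.
  by rewrite big_nil -c00; apply: tor_rel_lin => //; [exact: nfiD | exact: nfiM].
exists (fun t => a k * z k t + y t) => [|t]; last by rewrite big_cons yE.
by rewrite big_cons; apply: tor_rel_lin => //; [exact: nfiD | exact: nfiM].
Qed.

Lemma cl_supp j : supp_on i (cl j).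
Proof.
apply: emb_supp; have := hom_cyc (delta_mx 0 (tagged j));
  rewrite -rowE sub_capmx => /andP[h _].
by have /submxP[u ->] := h; rewrite -mulmxA prmxMr.
Qed.

Lemma cl_cycle j : inI I (koszulX (cl j)).
Proof.
have := hom_cyc (delta_mx 0 (tagged j));
  rewrite -rowE sub_capmx => /andP[_ /sub_kermxP h].
have := @koszulX_emb _ _ e (tag j) (row (tagged j) (row_base (hom (tag j)))); rewrite h.
rewrite emb0.
by rewrite subr0.
Qed.

Lemma bdI_proj W (c : Fun 1) : supp_on i c -> bdI I c -> (sqf_proj e W c <= bnd W)%MS.
Proof.
move=> sc [y [u [Iu cE]]].
have {cE} -> : c = (1%:MP : R) *: koszulX (layer i.+1 y) + layer i u.
  by rewrite -[LHS](layer_id sc) {1}cE raddfD /= koszulX_layer scale1r.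
rewrite proj_is_linear scale1r [X in _ + X]proj_inI ?addr0;
  last exact: inI_layer nfi0 _ _ Iu.
rewrite proj_koszulX -(proj_supp e W (@layer_supp n K 1 i.+1 y)) -mulmxA
  -/(lay_bdmx K _ _).
exact: submxMl.
Qed.

Lemma proj_cyc W (c : Fun 1) : supp_on i c -> inI I (koszulX c) ->
  (sqf_proj e W c <= cyc W)%MS.
Proof.
move=> sc Ic; rewrite sub_capmx; apply/andP; split.
  by rewrite -(proj_supp e W sc) submxMl.
by apply/sub_kermxP; rewrite -proj_koszulX proj_inI.
Qed.

Lemma bdID (c c' : Fun 1) : bdI I c -> bdI I c' -> bdI I (c + c').
Proof.
move=> [y [u [Iu ->]]] [y' [u' [Iu' ->]]]; exists (y + y'), (u + u'); split.
  by apply: inID; first exact: nfiD.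
by rewrite koszulXD addrACA.
Qed.

Lemma bdI0 : bdI I 0.
Proof. by exists 0, 0; split; [exact: inI0 nfi0 | rewrite koszulX0 addr0]. Qed.

Lemma emb_bnd W (v : 'rV[K]_N) : bdI I (sqf_emb e W (v *m bnd W)).
Proof.
rewrite /bnd /lay_bdmx mulmxA; set x := v *m _.
exists (sqf_emb e W x), (- (koszulX (sqf_emb e W x) - sqf_emb e W
  (x *m fbdmx K (coface W)))).
split; last by rewrite opprB addrC subrK.
by apply: inIN; [exact: nfiM | exact: koszulX_emb].
Qed.

(** The cycles [cl j], one for each basis vector of each [hom W], are matched by [tor_rel] with rows
    of constants. The matrix M of these rows is both row free and row full, hence square. *)
Lemma size_resolution : sz i = (\sum_W hbetti e K W i)%N.
Proof.
have /fin_all_exists[z zP] : forall j, exists z, rel (cl j) z.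
  move=> j; exact: (tor_rel_surj d_exact nfi0 nfiD nfiM aug_surj aug_exact
    (@cl_supp j) (@cl_cycle j)).
pose M := \matrix_(a < #|J|, k < sz i) z (enum_val a) k.
have ME (u : 'rV_#|J|) (k : 'I_(sz i)) :
    (u *m M) 0 k = \sum_j u 0 (enum_rank j) * z j k.
  rewrite mxE (reindex_onto (@enum_rank J) enum_val) => [|j _]; last exact: enum_valK.
  by apply: eq_big => j; rewrite ?mxE ?enum_rankK ?eqxx.
have -> : (\sum_W hbetti e K W i)%N = #|J|.
  rewrite card_tagged sumnE big_map big_enum /=; apply: eq_bigr => W _.
  by rewrite card_ord rank_hom.
(* A relation among the rows gives a combination of cycles with zero constants, thus a boundary; its
   projection to each W is a boundary inside [hom W], so all coefficients vanish. *)
have Mfree : row_free M.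
  rewrite -kermx_eq0; apply/rowV0P => u /sub_kermxP uM.
  have [y ry yE] := rel_sum (fun j => u 0 (enum_rank j)) zP.
  have yz k : (k < sz i)%N -> y k = 0.
    by move=> ki; rewrite yE; have /rowP/(_ (Ordinal ki)) := uM; rewrite ME mxE.
  set c := \sum_j _ in ry.
  have sc : supp_on i c.
    rewrite /c; apply: (big_ind (@supp_on _ _ _ i)) => [|f g sf sg|j _].
    - exact: supp0.
    - by rewrite -[f]scale1r; apply: supp_lin.
    by rewrite -[_ *: _]addr0; apply: supp_lin; [exact: cl_supp | exact: supp0].
  have cI : bdI I c.
    exact: (tor_rel_bd d_exact d_min nfiD aug_exact sc ry yz).
  pose uW W : 'rV_(\rank (hom W)) :=
    \row_k u 0 (enum_rank (Tagged (fun W => 'I_(\rank (hom W))) k : J)).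
  have u0 W : uW W = 0.
    apply: hom_free; suff <- : sqf_proj e W c = uW W *m row_base (hom W) by apply:
      bdI_proj.
    rewrite /c proj_lin_sum mulmx_sum_row.
    pose F W' (k : 'I_(\rank (hom W'))) : 'rV[K]_N :=
      u 0 (enum_rank (Tagged (fun W => 'I_(\rank (hom W))) k : J)) *:
      sqf_proj e W (sqf_emb e W' (row k (row_base (hom W')))).
    transitivity (\sum_W' \sum_k F W' k).
      rewrite (sig_big_dep xpredT (fun _ => xpredT)) /=.
      by apply: eq_bigr => -[W' k] _.
    rewrite (bigD1 W) //= [X in _ + X]big1 ?addr0 => [|W' W'W].
      apply: eq_bigr => k _; rewrite /F proj_emb eqxx mxE; congr (_ *: _).
      have := hom_cyc (delta_mx 0 k); rewrite -rowE sub_capmx => /andP[/submxP[t ->] _].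
      by rewrite -mulmxA prmxMr // => S /andP[].
    by rewrite big1 // => k _; rewrite /F proj_emb eq_sym (negPf W'W) scaler0.
  apply/rowP=> a; rewrite [RHS]mxE -(enum_valK a); case: (enum_val a) => W k.
  by have /rowP/(_ k) := u0 W; rewrite !mxE.
(* A cycle c with constants v is, modulo boundaries, the sum of its squarefree parts, and each of
   these is a combination of the [cl j]; the same combination of rows gives v. *)
have Mfull : row_full M.
  rewrite -sub1mx; apply/rV_subP=> v _.
  pose zv t := if insub t is Some k then v 0 k else 0 : K.
  have [c [sc Ic rc]] := tor_rel_exists d_exact d_min nfi0 aug_exact i zv.
  have /fin_all_exists[uu uuP] : forall W, exists u : 'rV_(\rank (hom W)),
      exists v, sqf_proj e W c = u *m row_base (hom W) + v *m bnd W.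
    by move=> W; apply: cyc_hom; apply: proj_cyc.
  pose uJ (j : J) := uu (tag j) 0 (tagged j).
  have [y ry yE] := rel_sum uJ zP.
  have cI : bdI I ((-1)%:MP *: (\sum_j (uJ j)%:MP *: cl j) + c).
    have -> : (-1)%:MP *: (\sum_j (uJ j)%:MP *: cl j) + c =
        (c - \sum_W sqf_emb e W (sqf_proj e W c)) +
        \sum_W (sqf_emb e W (sqf_proj e W c) - \sum_k (uu W 0 k)%:MP *: sqf_emb e W
          (row k (row_base (hom W)))).
      rewrite sumrB addrA subrK mpolyCN mpolyC1 scaleN1r [LHS]addrC; congr (_ - _).
      by rewrite (sig_big_dep xpredT (fun _ => xpredT)).
    apply: bdID; first exact: bdI_reconstruct.
    apply: (big_ind (bdI I)) => [|f g|W _]; [exact: bdI0|exact: bdID|].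
    have [v' ->] := uuP W; rewrite -emb_lin_sum mulmx_sum_row.
    set x := \sum_k _; have -> : x + v' *m bnd W = 1 *: x + v' *m bnd W by rewrite
      scale1r.
    by rewrite emb_is_linear mpolyC1 scale1r addrAC subrr add0r; apply: emb_bnd.
  have ez := tor_rel_inj d_exact d_min nfi0 nfiD nfiM aug_surj aug_exact
    (tor_rel_lin nfiD nfiM (-1) ry rc) cI.
  apply/submxP; exists (\row_a uJ (enum_val a)); apply/rowP=> k; rewrite ME.
  have := ez k (ltn_ord k); rewrite /zv valK mulN1r addrC => /eqP;
    rewrite subr_eq0 => /eqP ->.
  by rewrite yE; apply: eq_bigr => j _; rewrite mxE enum_rankK.
exact: etrans (esym (eqP Mfull)) (eqP Mfree).
Qed.

End Count.

(** * From graphs on a finite type to graphs on ordinals *)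

Section Transfer.
Variables (V : finType) (e : rel V) (K : fieldType).
Local Notation n := #|V|.

Definition ord_rel : rel 'I_n := fun i j => e (enum_val i) (enum_val j).

Lemma prod_vvar (W : {set V}) :
  \prod_(v in W) vvar K v = 'X_[mset [set enum_rank v | v in W]].
Proof.
rewrite mpolyXE_id (reindex_onto (@enum_val V predT) enum_rank) => [|v _];
  last exact: enum_rankK.
rewrite big_mkcond; apply: eq_bigr => i _.
rewrite enum_valK eqxx andbT msetE -(mem_imset _ _ enum_rank_inj) enum_valK /vvar.
by case: ifP => _; rewrite ?expr1 ?expr0 ?enum_valK.
Qed.

Lemma indep_imset (W : {set V}) :
  indep ord_rel [set enum_rank v | v in W] = (W \in indep_complex e).
Proof.
rewrite inE; apply/indepP/forall_inP =>
  [h u uW|h _ _ /imsetP[u uW ->] /imsetP[v vW ->]].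
  apply/forall_inP=> v vW.
  by have := h _ _ (imset_f _ uW) (imset_f _ vW); rewrite /ord_rel !enum_rankK.
by rewrite /ord_rel !enum_rankK; move/forall_inP: (h u uW); apply.
Qed.

Lemma sr_idealE (p : {mpoly K[n]}) :
  sr_ideal (indep_complex e) p <-> nonface_ideal ord_rel p.
Proof.
split=> [[c ->]|Ip].
  apply: (big_ind (nonface_ideal ord_rel)) => [|q r|W WD]; [exact: nfi0|exact: nfiD|].
  apply: nfiM => m; rewrite prod_vvar mcoeffX; case: (eqVneq (mset _) m) => [<- _|_];
    last by rewrite eqxx.
  by rewrite msup_mset indep_imset.
pose sW (m : 'X_{1..n}) : {set V} := [set enum_val i | i in msup m].
have sWE m : [set enum_rank v | v in sW m] = msup m.
  by rewrite -imset_comp (eq_imset _ (enum_valK (T := V))) imset_id.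
(* The coefficient at W collects the monomials of p with support W, each divided by the squarefree
   monomial of W. *)
exists (fun W => \sum_(m <- msupp p) if W == sW m then p@_m *: 'X_[m - mset (msup m)]
  else 0).
transitivity (\sum_(m <- msupp p) p@_m *: 'X_[m] : {mpoly K[n]}); first exact: mpolyE.
under [RHS]eq_bigr => W _ do rewrite mulr_suml.
rewrite exchange_big /= big_seq [RHS]big_seq; apply: eq_bigr => m mp.
have mD : sW m \notin indep_complex e.
  by rewrite -indep_imset sWE; apply: Ip; rewrite -mcoeff_msupp.
rewrite (bigD1 (sW m)) //= eqxx [X in _ + X]big1 ?addr0 => [|W /andP[_ /negPf->]];
  last by rewrite mul0r.
rewrite prod_vvar sWE -scalerAl -mpolyXD submK //.
by apply/mnm_lepP=> i; rewrite msetE inE; case: (m i).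
Qed.


Lemma betti_size n' (I : {mpoly K[n']} -> Prop) (F : min_graded_resolution I) i :
  betti F i = size (shifts F i).
Proof.
rewrite /betti /graded_betti -sum1_size -[RHS]big_undup_iterop_count /=.
by apply: eq_bigr => j _; rewrite Monoid.iteropE iter_addn_0 mul1n.
Qed.

Lemma betti_sum (F : min_graded_resolution (@sr_ideal V (indep_complex e) K)) i :
  betti F i = (\sum_W hbetti ord_rel K W i)%N.
Proof.
rewrite betti_size; apply: (@size_resolution _ K ord_rel i (fun a => size (shifts F a))
  (@res_diff _ _ _ F) _ _ (res_aug F)).
- exact: res_diff_exact.
- exact: res_minimal.
- by move=> p; have [v Iv] := res_aug_surj F p; exists v; apply/sr_idealE.
by move=> v; rewrite -sr_idealE; apply: res_aug_exact.
Qed.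
End Transfer.

Theorem theorem3p4 (V : finType) (e : rel V)
    (e_sym : symmetric e) (e_irr : irreflexive e) (i : nat) (hi : (i <= 5)%N)
    (K L : fieldType)
    (FK : min_graded_resolution (@sr_ideal V (indep_complex e) K))
    (FL : min_graded_resolution (@sr_ideal V (indep_complex e) L)) :
  betti FK i = betti FL i.
Proof.
rewrite !betti_sum; apply: eq_bigr => W _; apply: hbetti_field => // [u v|u].
  exact: e_sym.
exact: e_irr.
Qed.
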